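(* Let $G=(V,E)$ be an $n$-vertex graph of maximum degree $\Delta\ge3$, and let $\mu$ be a totally-connected and $b$-marginally bounded Gibbs distribution of a spin system on $G$ that satisfies $\eta$-spectral independence. If $b$ and $\eta$ are constants independent of $\Delta$ and $n$, then there exists a constant $c=c(\eta,b)>0$ such that $k$-partite factorization of entropy holds for $\mu$ with constant $C_{\mathrm{KPF}}=(\Delta\log n)^c$. Specifically, for every set of $k$ disjoint independent sets $V_1,\dots,V_k$ of $G$ such that $\bigcup_{j=1}^kV_j=V$ and every $f:\Omega\to\mathbb R_{\ge0}$, $$\mathrm{Ent}_\mu(f)\le\Big(\frac{C(\eta+1)^5\Delta\log n}{b^6}\Big)^{\kappa}\sum_{j=1}^k\mathrm E_{\tau\sim\mu_{V\setminus V_j}}\big[\mathrm{Ent}^\tau_{V_j}(f^\tau)\big],\quad\text{and}$$ $$\mathrm{Ent}_\mu(f)\le\Big(\frac{C(\eta+1)^5\Delta^4}{b^6}\Big)^{\kappa}\sum_{j=1}^k\mathrm E_{\tau\sim\mu_{V\setminus V_j}}\big[\mathrm{Ent}^\tau_{V_j}(f^\tau)\big],$$ where $\kappa:=2+\lceil\frac{2\eta}{b}\rceil$ and $C>0$ is a universal constant.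
   Context: Spin systems: $\mathcal S=\{1,\dots,q\}$. A spin system on $G$ is given by a symmetric $K:\mathcal S\times\mathcal S\to\mathbb R\cup\{-\infty\}$ and $U:\mathcal S\to\mathbb R$, possibly together with a boundary condition: $G$ may be an induced subgraph of a larger graph, and $\tau:(\partial V)_\tau\to\mathcal S$ is an assignment of spins to a (possibly empty) subset $(\partial V)_\tau$ of the vertices outside $V$ adjacent to $V$. The Hamiltonian is $H(\sigma)=-\sum_{\{u,v\}\in E}K(\sigma_u,\sigma_v)-\sum_{\{u,v\}:u\in V,v\in(\partial V)_\tau}K(\sigma_u,\tau_v)-\sum_{v\in V}U(\sigma_v)$ (the second sum over edges of the larger graph), and the Gibbs distribution is $\mu(\sigma)=e^{-H(\sigma)}/Z$, with $e^{-\infty}=0$ and $Z>0$. $\Omega\subseteq\mathcal S^V$ denotes its support. Pinnings: for $\Lambda\subseteq V$, $\Omega_\Lambda=\{\tau\in\mathcal S^\Lambda:\mu(\sigma_\Lambda=\tau)>0\}$ and $\mu_\Lambda$ is the marginal of $\mu$ on $\Lambda$; for $\tau\in\Omega_\Lambda$ and $W\subseteq V\setminus\Lambda$, $\Omega_W^\tau=\{\xi\in\mathcal S^W:\mu(\sigma_W=\xi\mid\sigma_\Lambda=\tau)>0\}$; $\mathcal P^\tau=\{(u,s):u\in V\setminus\Lambda,s\in\Omega_{\{u\}}^\tau\}$. Totally-connected: for every $\Lambda\subseteq V$ and $\tau\in\Omega_\Lambda$, the graph on $\Omega^\tau_{V\setminus\Lambda}$ whose edges join configurations differing at exactly one vertex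 is connected. $\eta$-spectral independence ($\eta>0$): for every $\Lambda\subseteq V$ (with $V\setminus\Lambda\ne\emptyset$) and $\tau\in\Omega_\Lambda$, the largest eigenvalue of $\Psi^\tau_\mu\in\mathbb R^{\mathcal P^\tau\times\mathcal P^\tau}$ is at most $\eta$, where $\Psi^\tau_\mu((u,a),(v,b'))=\mu(\sigma_v=b'\mid\sigma_u=a,\sigma_\Lambda=\tau)-\mu(\sigma_v=b'\mid\sigma_\Lambda=\tau)$ for $u\ne v$ and $0$ if $u=v$. $b$-marginally bounded ($b>0$): for every $\Lambda\subseteq V$, $\tau\in\Omega_\Lambda$ and $(v,s)\in\mathcal P^\tau$, $\mu(\sigma_v=s\mid\sigma_\Lambda=\tau)\ge b$. Entropy: $\mathrm{Ent}_\mu(f)=\mathrm E_\mu[f\log f]-\mathrm E_\mu[f]\log\mathrm E_\mu[f]$ (with $0\log0=0$). For $B\subseteq V$ and $\tau\in\Omega_{V\setminus B}$, $f^\tau:\Omega_B^\tau\to\mathbb R_{\ge0}$ is $f^\tau(\sigma)=f(\tau\cup\sigma)$, $\mu_B^\tau=\mu(\sigma_B\in\cdot\mid\sigma_{V\setminus B}=\tau)$, and $\mathrm{Ent}_B^\tau(f^\tau)=\mathrm{Ent}_{\mu_B^\tau}(f^\tau)$. $k$-partite factorization of entropy (KPF) with constant $C_{\mathrm{KPF}}$: for disjoint independent sets $U_1,\dots,U_k$ of $G$ with union $V$ and all $f:\Omega\to\mathbb R_{\ge0}$, $\mathrm{Ent}_\mu(f)\le C_{\mathrm{KPF}}\sum_{i=1}^k\mathrm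 E_{\tau\sim\mu_{V\setminus U_i}}[\mathrm{Ent}^\tau_{U_i}(f^\tau)]$. *)

(* Defs.v *)
(* The spins 1, ..., q are the elements of 'I_q. *)
From HB Require Import structures.
From mathcomp Require Import all_boot all_order all_algebra.
From mathcomp Require Import reals constructive_ereal ereal exp.

Set Implicit Arguments.
Unset Strict Implicit.
Unset Printing Implicit Defensive.

Import Order.TTheory GRing.Theory Num.Theory.
Local Open Scope ring_scope.

Record sgraph (V : finType) := SGraph {
  adj :> rel V;
  adj_sym : symmetric adj;
  adj_irrefl : irreflexive adj }.

Definition max_degree (V : finType) (G : sgraph V) : nat :=
  \max_(v : V) #|[set u | G v u]|.

Definition independent (V : finType) (G : sgraph V) (A : {set V}) : Prop :=
  forall u v, u \in A -> v \in A -> ~~ G u v.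

(* The finitely many vertices of the larger graph that carry no spin of the
   boundary condition and lie outside G play no role, so the larger graph may be
   taken finite. The absence of a boundary condition is bc_dom = set0. *)
Record boundary_condition (V : finType) (G : sgraph V) (q : nat) :=
  BoundaryCondition {
  bc_vertex : finType;
  bc_graph : sgraph bc_vertex;
  bc_emb : V -> bc_vertex;
  bc_emb_inj : injective bc_emb;
  bc_induced : forall u v, bc_graph (bc_emb u) (bc_emb v) = G u v;
  bc_dom : {set bc_vertex};
  bc_outside : forall v, bc_emb v \notin bc_dom;
  bc_adjacent : forall w, w \in bc_dom -> exists v, bc_graph (bc_emb v) w;
  bc_spin : {w : bc_vertex | w \in bc_dom} -> 'I_q }.

Record spin_system (R : realType) (q : nat) := SpinSystem {
  interaction : 'I_q -> 'I_q -> \bar R;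
  interaction_sym : forall s t, interaction s t = interaction t s;
  interaction_lty : forall s t, (interaction s t < +oo)%E;
  self_energy : 'I_q -> R }.

Section Gibbs.
Variables (R : realType) (V : finType) (G : sgraph V) (q : nat).
Variables (S : spin_system R q) (bc : boundary_condition G q).

(* In the first sum, enum_rank selects one orientation of every edge; which one
   does not matter, as the interaction is symmetric. *)
Definition hamiltonian (sigma : {ffun V -> 'I_q}) : \bar R :=
  (- (\sum_(p : V * V | G p.1 p.2 && (enum_rank p.1 < enum_rank p.2)%N)
        interaction S (sigma p.1) (sigma p.2))
   - (\sum_(p : V * {w | w \in bc_dom bc} |
              bc_graph bc (bc_emb bc p.1) (val p.2))
        interaction S (sigma p.1) (bc_spin p.2))
   - (\sum_(v : V) self_energy S (sigma v))%:E)%E.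

Definition weight (sigma : {ffun V -> 'I_q}) : R :=
  fine (expeR (- hamiltonian sigma)%E).

Definition partition_function : R := \sum_(sigma : {ffun V -> 'I_q}) weight sigma.

Definition gibbs (sigma : {ffun V -> 'I_q}) : R :=
  weight sigma / partition_function.

End Gibbs.

Section FiniteProbability.
Variables (R : realType) (T : finType) (p : T -> R).

Definition Pr (A : {set T}) : R := \sum_(x in A) p x.

Definition cPr (A B : {set T}) : R := Pr (A :&: B) / Pr B.

Definition Ex (f : T -> R) : R := \sum_x p x * f x.

(* [ln 0 = 0] in the library, hence 0 log 0 = 0. *)
Definition Ent (f : T -> R) : R :=
  Ex (fun x => f x * ln (f x)) - Ex f * ln (Ex f).

End FiniteProbability.

Section Pinnings.
Variables (R : realType) (V : finType) (q : nat).
Variable mu : {ffun V -> 'I_q} -> R.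

Definition pconf (L : {set V}) := {ffun {v : V | v \in L} -> 'I_q}.

Definition restr (L : {set V}) (sigma : {ffun V -> 'I_q}) : pconf L :=
  [ffun v => sigma (val v)].

Definition glue (B : {set V}) (tau : pconf (~: B)) (xi : pconf B) :
    {ffun V -> 'I_q} :=
  [ffun v => match boolP (v \in B) with
             | AltTrue vB => xi (exist _ v vB)
             | AltFalse vB => tau (exist _ v (etrans (in_setC v B) vB))
             end].

(* the events sigma_L = tau and sigma_v = s *)
Definition agree (L : {set V}) (tau : pconf L) : {set {ffun V -> 'I_q}} :=
  [set sigma | restr L sigma == tau].

Definition spin_at (v : V) (s : 'I_q) : {set {ffun V -> 'I_q}} :=
  [set sigma : {ffun V -> 'I_q} | sigma v == s].

Definition marginal (L : {set V}) (tau : pconf L) : R := Pr mu (agree tau).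

Definition Omega : {set {ffun V -> 'I_q}} := [set sigma | 0 < mu sigma].

Definition Omega_on (L : {set V}) : {set pconf L} :=
  [set tau | 0 < marginal tau].

Definition cond_marginal (L : {set V}) (tau : pconf L) (W : {set V})
    (xi : pconf W) : R :=
  cPr mu (agree xi) (agree tau).

Definition Omega_cond (L : {set V}) (tau : pconf L) (W : {set V}) :
    {set pconf W} :=
  [set xi | 0 < cond_marginal tau xi].

Definition feasible (L : {set V}) (tau : pconf L) : {set V * 'I_q} :=
  [set us | (us.1 \notin L) && (0 < cPr mu (spin_at us.1 us.2) (agree tau))].

Definition flip_rel (L : {set V}) (tau : pconf L) : rel (pconf (~: L)) :=
  [rel x y | [&& x \in Omega_cond tau (~: L), y \in Omega_cond tau (~: L)
               & #|[set v | x v != y v]| == 1%N]].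

Definition totally_connected : Prop :=
  forall (L : {set V}) (tau : pconf L), tau \in Omega_on L ->
  forall x y, x \in Omega_cond tau (~: L) -> y \in Omega_cond tau (~: L) ->
    connect (flip_rel tau) x y.

Definition Psi (L : {set V}) (tau : pconf L) : 'M[R]_#|feasible tau| :=
  \matrix_(i, j)
    let: (u, a) := enum_val i in
    let: (v, b) := enum_val j in
    if u == v then 0
    else cPr mu (spin_at v b) (spin_at u a :&: agree tau)
         - cPr mu (spin_at v b) (agree tau).

(* All complex eigenvalues of [Psi tau] are real: it is self-adjoint for the
   inner product weighted by mu (sigma_u = a | sigma_L = tau). *)
Definition spectrally_independent (eta : R) : Prop :=
  forall (L : {set V}) (tau : pconf L), ~: L != set0 -> tau \in Omega_on L ->
  forall a : R, eigenvalue (Psi tau) a -> a <= eta.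

Definition marginally_bounded (b : R) : Prop :=
  forall (L : {set V}) (tau : pconf L), tau \in Omega_on L ->
  forall (v : V) (s : 'I_q), (v, s) \in feasible tau ->
    b <= cPr mu (spin_at v s) (agree tau).

(* E_{tau ~ mu_{V \ B}} [Ent_B^tau (f^tau)] *)
Definition expected_Ent (B : {set V}) (f : {ffun V -> 'I_q} -> R) : R :=
  Ex (fun tau : pconf (~: B) => marginal tau)
     (fun tau => Ent (fun xi : pconf B => cond_marginal tau xi)
                     (fun xi => f (glue tau xi))).

(* f is only constrained on Omega: its values elsewhere have weight zero in all
   the expectations, so this amounts to quantifying over f : Omega -> R_{>=0}. *)
Definition KPF (G : sgraph V) (k : nat) (C : R) : Prop :=
  forall U : 'I_k -> {set V},
    (forall i j, i != j -> [disjoint U i & U j]) ->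
    (forall i, independent G (U i)) ->
    \bigcup_(i < k) U i = [set: V] ->
  forall f : {ffun V -> 'I_q} -> R, (forall sigma, sigma \in Omega -> 0 <= f sigma) ->
    Ent mu f <= C * \sum_(i < k) expected_Ent (U i) f.

End Pinnings.

(* Main.v *)
Require Import Defs.
From mathcomp Require Import all_boot all_order all_algebra.
From mathcomp Require Import reals constructive_ereal ereal exp.
From mathcomp Require Import sequences topology normedtype derive realfun.
From mathcomp Require Import complex spectral sesquilinear ring lra zify.
Import numFieldNormedType.Exports.
Set Implicit Arguments.
Unset Strict Implicit.
Unset Printing Implicit Defensive.
Import Order.TTheory GRing.Theory Num.Theory.
Local Open Scope ring_scope.

(** For a block S of sites let h(S) be the expected entropy of f on S given the
    spins outside S ([block_ent]); thus h(V) is the entropy of f, and the sum on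
    the right of the factorization inequality is the sum of h over the
    independent sets V_j.  The proof compares h(V) with the average of h over
    random blocks containing each site independently with probability theta, and
    then breaks a random block into its connected components.

    Random blocks.  Fix the spins outside S, let f_T be the conditional
    expectation of f given the spins outside T, and compare S with S minus one
    or two sites.  From a ln a - a ln c >= a - c, the mixed second difference
    of h at two sites u, v of S is bounded below by minus a covariance of
    f_(S-u) and f_(S-v), divided by f_S ([ent_second_difference_ge]).  Summed
    over u and v these covariances form a quadratic form of the influence
    matrix; spectral independence bounds it by eta times a sum of variances
    ([cov_le_chi2]), and marginal boundedness gives f_(S-u) <= f_S / b, so that
    these variances cost at most 2/b times an entropy ([chi2_le_ent]).  With
    rho = 2 eta / b, induction on S yields
      (|S| - 1 - rho) h(S) <= sum over u in S of h(S - u)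
    ([block_ent_remove_site]).  Iterating this from V downwards and integrating
    against the binomial law gives theta^(r+1) h(V) <= E[h(random block)] for
    any integer r >= rho ([bernoulli_sum_ge]).

    Components.  On a connected set C, total connectedness and the bound
    b^|C| on conditional probabilities give a tensorization of entropy into
    single sites with the constant 4 b^(-4|C|)
    ([crude_entropy_tensorization]).  This grows exponentially in |C|, but the
    component of a given site in the random block has an exponentially small
    tail once theta is of order b^4 / Delta.  The components of a block are
    independent given the outside, so the chain rule reduces h(S) to
    single-site terms ([block_ent_le_components]).  These terms must be
    recombined into h(V_j) and not merely bounded one by one, since
    sum over v in V_j of h(v) may be much larger than h(V_j).  For this the
    site-v term keeps the averaging over those isolated sites of S that come
    later than v and lie in the same V_j.  Replacing the component C of v by
    the single site v changes the probability of the block by the factor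
    (theta / (1 - theta))^(|C|-1), does not change that term, and makes v an
    isolated site; the terms of the isolated sites add up, by the chain rule on
    an independent set, to at most the sum of the h(V_j)
    ([average_components_le]).  The remaining sum over connected sets C
    containing v is at most 1 for weights below 1/(4 Delta) per site, as the
    probabilities that C is the component of v in site percolation add up to
    at most 1 ([sum_connected_sets]).

    Altogether h(V) <= 4 (8 Delta / b^4)^(r+2) times the sum of the h(V_j)
    ([partite_factorization]), and with r the ceiling of rho, all three
    constants of the theorem dominate this one. *)

(** * Inequalities for x ln x *)

Section Scalar.
Variable R : realType.
Implicit Types a c x M t s : R.

Lemma xlnx_sub_ge a c : 0 <= a -> 0 <= c -> (c = 0 -> a = 0) ->
  a - c <= a * ln a - a * ln c.
Proof.
move=> a0 c0 ca; have [aE|an0] := eqVneq a 0.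
  by rewrite aE !mul0r !sub0r oppr0 oppr_le0.
have ap : 0 < a by rewrite lt0r an0.
have cp : 0 < c.
  by rewrite lt0r c0 andbT; apply: contra an0 => /eqP/ca ->.
have ra : 0 < c / a by rewrite divr_gt0.
have := @le_ln1Dx R (c / a - 1); rewrite addrCA subrr addr0 => /(_ _) h.
have {}h : ln (c / a) <= c / a - 1 by apply: h; lra.
rewrite ln_div ?posrE // in h.
have := ler_wpM2l a0 h.
have -> : a * (c / a - 1) = c - a by field.
by rewrite mulrBr; lra.
Qed.

(** Both quadratic bounds below compare two functions that agree at 1, where the
    sign of the derivative on ]0, 1] decides. *)
Lemma nonincreasing_ge0 (g g' : R -> R) : g 1 = 0 ->
  (forall t, 0 < t -> is_derive t 1 g (g' t)) ->
  (forall t, 0 < t <= 1 -> g' t <= 0) ->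
  forall t, 0 < t <= 1 -> 0 <= g t.
Proof.
move=> g1 dg g'0 t /andP[t0 t1]; rewrite -g1.
apply: (@ler0_derive1_nincr R g t 1) => // [x|x|].
- rewrite in_itv /= => /andP[tx _]; have x0 := lt_trans t0 tx.
  by apply: ex_derive; exact: dg.
- rewrite in_itv /= => /andP[tx x1]; have x0 := lt_trans t0 tx.
  have d := dg x x0; rewrite derive1E derive_val; apply: g'0.
  by rewrite x0 ltW.
- apply: derivable_within_continuous => x; rewrite in_itv /= => /andP[tx _].
  by apply: ex_derive; apply: dg; exact: lt_le_trans tx.
Qed.

Lemma xlnx_ge_quad_le1 t : 0 < t <= 1 -> (t - 1) ^+ 2 / 2 <= t * ln t - t + 1.
Proof.
pose g (s : R) := s * ln s - s + 1 - (s - 1) ^+ 2 / 2.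
move=> h; rewrite -subr_ge0 -/(g t).
apply: (@nonincreasing_ge0 g (fun s => ln s - (s - 1))) h.
- by rewrite /g ln1; ring.
- move=> s s0; have dl := is_derive1_ln s0; rewrite /g.
  apply: is_derive_eq; rewrite !(scaler0, scaler1, expr1, add0r, addr0, subr0).
  rewrite /GRing.scale /=; field; exact: lt0r_neq0.
- move=> s /andP[s0 s1]; have := @le_ln1Dx R (s - 1); rewrite addrCA subrr addr0.
  by move=> /(_ _) h; rewrite subr_le0 h //; lra.
Qed.

Lemma ln_le_quad s : 0 < s <= 1 -> ln s <= 2 * s - s ^+ 2 / 2 - 3 / 2.
Proof.
pose g (s : R) := 2 * s - s ^+ 2 / 2 - 3 / 2 - ln s.
move=> h; rewrite -subr_ge0 -/(g s).
apply: (@nonincreasing_ge0 g (fun s => 2 - s - s^-1)) h.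
- by rewrite /g ln1; field.
- move=> {}s s0; have dl := is_derive1_ln s0; rewrite /g.
  apply: is_derive_eq; rewrite !(scaler0, scaler1, expr1, add0r, addr0, subr0).
  rewrite /GRing.scale /=; field; exact: lt0r_neq0.
- move=> {}s /andP[s0 s1].
  have -> : 2 - s - s^-1 = - ((s - 1) ^+ 2 / s) by field; exact: lt0r_neq0.
  by rewrite oppr_le0 divr_ge0 ?sqr_ge0 // ltW.
Qed.

(** The second derivative of x ln x is 1/x >= 1/M on ]0, M], so the Bregman
    divergence of x ln x at c is at least (x - c)^2 / (2 M).  The factor 2 is the
    one that makes rho = 2 eta / b. *)
Lemma xlnx_sub_ge_quad x c M : 0 <= x <= M -> 0 < c <= M ->
  (x - c) ^+ 2 / (2 * M) <= x * ln x - x * ln c - x + c.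
Proof.
move=> /andP[x0 xM] /andP[c0 cM]; have M0 := lt_le_trans c0 cM.
have le_quad d : 0 < d <= M -> (x - c) ^+ 2 / (2 * M) <= (x - c) ^+ 2 / (2 * d).
  move=> /andP[d0 dM]; apply: ler_wpM2l; first exact: sqr_ge0.
  by rewrite lef_pV2 ?posrE ?mulr_gt0 // ler_pM2l.
have [xE|xn0] := eqVneq x 0.
  apply: le_trans (le_quad c _) _; first by rewrite c0.
  rewrite xE !mul0r !sub0r oppr0 !add0r sqrrN.
  have -> : c ^+ 2 / (2 * c) = c / 2 by field; exact: lt0r_neq0.
  lra.
have xp : 0 < x by rewrite lt0r xn0.
have [xc|cx] := lerP x c.
  apply: le_trans (le_quad c _) _; first by rewrite c0.
  have t01 : 0 < x / c <= 1 by rewrite divr_gt0 //= ler_pdivrMr // mul1r.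
  have := ler_wpM2l (ltW c0) (xlnx_ge_quad_le1 t01).
  rewrite ln_div ?posrE //; apply: etrans.
  by congr (_ <= _); field; exact: lt0r_neq0.
apply: le_trans (le_quad x _) _; first by rewrite xp.
have t01 : 0 < c / x <= 1 by rewrite divr_gt0 //= ler_pdivrMr // mul1r ltW.
have := ler_wpM2l (ltW xp) (ln_le_quad t01).
rewrite ln_div ?posrE // => h.
rewrite -subr_ge0; rewrite -subr_ge0 in h; apply: le_trans h _.
rewrite le_eqVlt; apply/orP; left; apply/eqP; field; exact: lt0r_neq0.
Qed.
End Scalar.

(** * Resampling a block and the entropy it dissipates *)

Section Resampling.
Variables (R : realType) (V : finType) (q : nat).
Local Notation conf := {ffun V -> 'I_q}.
Variable mu : conf -> R.
Hypothesis mu_ge0 : forall x, 0 <= mu x.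
Implicit Types (S T A B : {set V}) (x y z : conf) (f g k a b : conf -> R).

Definition agree_off S x y := [forall v, (v \notin S) ==> (x v == y v)].

Lemma agree_offP S x y :
  reflect (forall v, v \notin S -> x v = y v) (agree_off S x y).
Proof.
by apply: (iffP forallP) => h v; [move=> vS; apply/eqP; move: (h v); rewrite vS
  | apply/implyP => /h ->].
Qed.

Lemma agree_off_refl S x : agree_off S x x.
Proof. exact/agree_offP. Qed.

Lemma agree_off_sym S x y : agree_off S x y = agree_off S y x.
Proof. by apply: eq_forallb => v; rewrite eq_sym. Qed.

Lemma agree_off_trans S y x z :
  agree_off S x y -> agree_off S y z -> agree_off S x z.
Proof.
by move=> /agree_offP h /agree_offP k; apply/agree_offP => v vS; rewrite h ?k.
Qed.

Lemma agree_off_sub S T x y : S \subset T -> agree_off S x y -> agree_off T x y.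
Proof.
move=> /subsetP ST /agree_offP h; apply/agree_offP => v vT; apply: h.
by apply: contra vT => /ST.
Qed.

Lemma agree_off_left S x y z : agree_off S x y -> agree_off S x z = agree_off S y z.
Proof.
move=> xy; apply/idP/idP => h; last exact: agree_off_trans xy h.
by rewrite agree_off_sym in xy; exact: agree_off_trans xy h.
Qed.

Lemma agree_off0 x y : agree_off set0 x y = (x == y).
Proof.
apply/agree_offP/eqP => [h|-> //]; apply/ffunP => v; apply: h; by rewrite in_set0.
Qed.

Lemma agree_offT x y : agree_off setT x y.
Proof. by apply/agree_offP => v; rewrite in_setT. Qed.

Definition mass S x : R := \sum_(y | agree_off S x y) mu y.

(** The conditional expectation of g given the spins outside S, at the outside
    spins of x.  It is a function of whole configurations, constant on the
    classes of [agree_off S], so that pinnings and conditional measures need no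
    dependent types. *)
Definition resample S g x : R :=
  (\sum_(y | agree_off S x y) mu y * g y) / mass S x.

Lemma mass_agree S x y : agree_off S x y -> mass S x = mass S y.
Proof. by move=> xy; apply: eq_bigl => z; exact: agree_off_left. Qed.

Lemma resample_agree S g x y : agree_off S x y -> resample S g x = resample S g y.
Proof.
move=> xy; rewrite /resample (mass_agree xy); congr (_ / _).
by apply: eq_bigl => z; exact: agree_off_left.
Qed.

Lemma mass_ge_mu S x : mu x <= mass S x.
Proof.
rewrite /mass (bigD1 x) ?agree_off_refl //= lerDl.
by apply: sumr_ge0.
Qed.

Lemma mass_gt0 S x : 0 < mu x -> 0 < mass S x.
Proof. by move=> h; apply: lt_le_trans (mass_ge_mu S x). Qed.

Lemma mass_ge0 S x : 0 <= mass S x.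
Proof. by apply: sumr_ge0. Qed.

Lemma mass0E x : mass set0 x = mu x.
Proof.
rewrite /mass (big_pred1 x) // => y; by rewrite agree_off0 eq_sym.
Qed.

Lemma mass_sub S T x : S \subset T -> mass S x <= mass T x.
Proof.
move=> ST; rewrite /mass [leRHS](bigID (agree_off S x)) /=.
rewrite [X in _ <= X + _](eq_bigl (agree_off S x)); last first.
  move=> y; case h: (agree_off S x y); rewrite ?andbF // andbT.
  exact: agree_off_sub ST h.
by rewrite lerDl; apply: sumr_ge0.
Qed.

(** The tower property on a union P of classes; P is a predicate, so that the
    identity serves both for expectations and for nested conditioning. *)
Lemma sum_resample (P : pred conf) S g :
  (forall x y, agree_off S x y -> P x = P y) ->
  \sum_(x | P x) mu x * resample S g x = \sum_(x | P x) mu x * g x.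
Proof.
move=> Pinv; under eq_bigr do rewrite /resample mulr_suml mulr_sumr.
rewrite (exchange_big_dep P) /=; last by move=> x y Px xy; rewrite -(Pinv _ _ xy).
apply: eq_bigr => z Pz.
have [mz|mz] := eqVneq (mu z) 0.
  by rewrite mz mul0r big1 // => i _; rewrite !mul0r mulr0.
have zp : 0 < mass S z by apply: mass_gt0; rewrite lt0r mz mu_ge0.
transitivity (\sum_(y | agree_off S z y) mu y * (mu z * g z / mass S z)).
  apply: congr_big => // [y|y /andP[_ yz]].
    rewrite agree_off_sym; case h: (agree_off S z y); rewrite ?andbF // andbT.
    by rewrite -(Pinv _ _ h).
  by rewrite (mass_agree yz).
rewrite -mulr_suml -/(mass S z); field; exact: lt0r_neq0.
Qed.

Lemma Ex_resample S g : Ex mu (resample S g) = Ex mu g.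
Proof. exact: (@sum_resample xpredT). Qed.

Definition invariant S k := forall x y, agree_off S x y -> k x = k y.

Lemma resampleM S g k x : invariant S k ->
  resample S (fun y => g y * k y) x = resample S g x * k x.
Proof.
move=> kinv; rewrite /resample mulrAC; congr (_ / _); rewrite mulr_suml.
by apply: eq_bigr => y xy; rewrite mulrA (kinv _ _ xy).
Qed.

(** Self-adjointness of conditional expectation, in the only form that entropy
    computations use. *)
Lemma Ex_resampleM S g k : invariant S k ->
  Ex mu (fun x => g x * k x) = Ex mu (fun x => resample S g x * k x).
Proof.
move=> kinv; rewrite -(Ex_resample S); apply: eq_bigr => x _.
by rewrite resampleM.
Qed.

Lemma resample_resample S T g x : T \subset S ->
  resample S (resample T g) x = resample S g x.
Proof.
move=> TS; rewrite /resample sum_resample // => y z yz.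
rewrite ![agree_off S x _]agree_off_sym.
by apply: agree_off_left; exact: agree_off_sub yz.
Qed.

Lemma le_Ex f g : (forall x, 0 < mu x -> f x <= g x) -> Ex mu f <= Ex mu g.
Proof.
move=> fg; apply: ler_sum => x _; have [m0|m0] := eqVneq (mu x) 0.
  by rewrite m0 !mul0r.
by apply: ler_wpM2l => //; apply: fg; rewrite lt0r m0 mu_ge0.
Qed.

Lemma eq_Ex f g : (forall x, 0 < mu x -> f x = g x) -> Ex mu f = Ex mu g.
Proof. by move=> fg; apply/le_anti; rewrite !le_Ex // => x /fg ->. Qed.

Lemma ExD f g : Ex mu (fun x => f x + g x) = Ex mu f + Ex mu g.
Proof. by rewrite /Ex -big_split; apply: eq_bigr => x _; rewrite mulrDr. Qed.

Lemma ExB f g : Ex mu (fun x => f x - g x) = Ex mu f - Ex mu g.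
Proof. by rewrite /Ex -sumrB; apply: eq_bigr => x _; rewrite mulrBr. Qed.

Lemma ExZ (c : R) f : Ex mu (fun x => c * f x) = c * Ex mu f.
Proof. by rewrite /Ex mulr_sumr; apply: eq_bigr => x _; rewrite mulrCA. Qed.

Lemma Ex_sum (I : finType) (P : pred I) (F : I -> conf -> R) :
  Ex mu (fun x => \sum_(i | P i) F i x) = \sum_(i | P i) Ex mu (F i).
Proof.
rewrite /Ex exchange_big; apply: eq_bigr => x _; by rewrite mulr_sumr.
Qed.

Lemma resample_ge0 S g x : (forall y, 0 <= g y) -> 0 <= resample S g x.
Proof.
move=> g0; rewrite divr_ge0 ?mass_ge0 // sumr_ge0 // => y _.
by rewrite mulr_ge0.
Qed.

Lemma eq_resample S f g x : (forall y, agree_off S x y -> 0 < mu y -> f y = g y) ->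
  resample S f x = resample S g x.
Proof.
move=> fg; congr (_ / _); apply: eq_bigr => y xy.
have [m0|m0] := eqVneq (mu y) 0; first by rewrite m0 !mul0r.
by rewrite fg // lt0r m0 mu_ge0.
Qed.

Lemma resample_le S f g x :
  (forall y, agree_off S x y -> 0 < mu y -> f y <= g y) ->
  resample S f x <= resample S g x.
Proof.
move=> fg; apply: ler_wpM2r; first by rewrite invr_ge0 mass_ge0.
apply: ler_sum => y xy.
have [m0|m0] := eqVneq (mu y) 0; first by rewrite m0 !mul0r.
by apply: ler_wpM2l => //; apply: fg; rewrite ?lt0r ?m0 ?mu_ge0.
Qed.

Lemma resample_cst S (c : R) x : 0 < mu x -> resample S (fun=> c) x = c.
Proof.
move=> mx; rewrite /resample -mulr_suml -/(mass S x).
have := mass_gt0 S mx; set m := mass S x => mp; field; exact: lt0r_neq0.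
Qed.

Lemma resampleD S f g x :
  resample S (fun y => f y + g y) x = resample S f x + resample S g x.
Proof.
rewrite /resample -mulrDl -big_split; congr (_ / _).
by apply: eq_bigr => y _; rewrite mulrDr.
Qed.

Lemma resampleZ S (c : R) f x :
  resample S (fun y => c * f y) x = c * resample S f x.
Proof.
rewrite /resample mulrA mulr_sumr; congr (_ / _).
by apply: eq_bigr => y _; rewrite mulrCA.
Qed.

Lemma resampleB S f g x :
  resample S (fun y => f y - g y) x = resample S f x - resample S g x.
Proof.
rewrite /resample -mulrBl -sumrB; congr (_ / _).
by apply: eq_bigr => y _; rewrite mulrBr.
Qed.

Lemma resample_sum S (I : finType) (P : pred I) (F : I -> conf -> R) x :
  resample S (fun y => \sum_(i | P i) F i y) x =
  \sum_(i | P i) resample S (F i) x.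
Proof.
rewrite /resample -mulr_suml exchange_big; congr (_ / _).
by apply: eq_bigr => y _; rewrite mulr_sumr.
Qed.

Lemma resample_ge_part S g x : (forall y, 0 <= g y) ->
  mu x * g x <= mass S x * resample S g x.
Proof.
move=> g0; have [m0|m0] := eqVneq (mass S x) 0.
  have := mass_ge_mu S x; rewrite m0 => mx.
  have -> : mu x = 0 by apply/le_anti; rewrite mx mu_ge0.
  by rewrite !mul0r.
rewrite /resample mulrCA mulfV // mulr1 (bigD1 x) ?agree_off_refl //= lerDl.
by apply: sumr_ge0 => y _; rewrite mulr_ge0.
Qed.

Lemma resample_eq0 S g x : (forall y, 0 <= g y) -> 0 < mu x ->
  resample S g x = 0 -> g x = 0.
Proof.
move=> g0 mx e; have := resample_ge_part S x g0; rewrite e mulr0.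
by rewrite pmulr_rle0 // => h; apply/le_anti; rewrite h g0.
Qed.

Lemma resample_set0 g x : 0 < mu x -> resample set0 g x = g x.
Proof.
move=> mx; rewrite /resample mass0E (big_pred1 x); last first.
  by move=> y; rewrite agree_off0 eq_sym.
by field; exact: lt0r_neq0.
Qed.

(** The expectation, over the spins outside S, of the entropy of f under the
    conditional law on S: the term mean * ln mean of each conditional entropy is
    collected in the second expectation. *)
Definition block_ent S f : R :=
  Ex mu (fun x => f x * ln (f x))
  - Ex mu (fun x => resample S f x * ln (resample S f x)).

Lemma block_entE S f : block_ent S f =
  Ex mu (fun x => f x * ln (f x) - f x * ln (resample S f x)).
Proof.
rewrite /block_ent ExB; congr (_ - _); apply/esym/Ex_resampleM => x y xy.
by rewrite (resample_agree _ xy).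
Qed.

Lemma eq_block_ent S f g : (forall x, 0 < mu x -> f x = g x) ->
  block_ent S f = block_ent S g.
Proof.
move=> fg; congr (_ - _); apply: eq_Ex => x mx; first by rewrite fg.
by rewrite (@eq_resample _ f g) // => y _; exact: fg.
Qed.

Lemma block_ent_ge0 S f : (forall x, 0 <= f x) -> 0 <= block_ent S f.
Proof.
move=> f0; rewrite block_entE -(subrr (Ex mu f)) -[X in _ - X](Ex_resample S).
rewrite -ExB; apply: le_Ex => x mx; apply: xlnx_sub_ge => //.
  exact: resample_ge0.
exact: resample_eq0.
Qed.

Lemma block_ent_set0 f : block_ent set0 f = 0.
Proof.
apply/eqP; rewrite subr_eq0; apply/eqP/eq_Ex => x mx.
by rewrite resample_set0.
Qed.

(** Chain rule: what resampling S dissipates is what resampling T dissipates,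
    plus what S dissipates afterwards. *)
Lemma block_ent_chain S T f : T \subset S ->
  block_ent S f = block_ent T f + block_ent S (resample T f).
Proof.
move=> TS; rewrite /block_ent [X in _ = _ + (_ - X)](_ : _ =
  Ex mu (fun x => resample S f x * ln (resample S f x))); first by ring.
by apply: eq_bigr => x _; rewrite resample_resample.
Qed.

Lemma block_ent_sub S T f : T \subset S -> (forall x, 0 <= f x) ->
  block_ent T f <= block_ent S f.
Proof.
move=> TS f0; rewrite (block_ent_chain _ TS) lerDl block_ent_ge0 // => x.
exact: resample_ge0.
Qed.

(** Relative entropy decreases under conditional expectation (log-sum
    inequality).  The difference of both sides is the expectation of
    a ln a - a ln c with c = b * (resampled a / resampled b), hence at least the
    expectation of a - c, which vanishes. *)
Lemma relative_entropy_resample S a b :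
  (forall x, 0 <= a x) -> (forall x, 0 <= b x) ->
  (forall x, 0 < mu x -> b x = 0 -> a x = 0) ->
  Ex mu (fun x => resample S a x * ln (resample S a x)
                  - resample S a x * ln (resample S b x))
  <= Ex mu (fun x => a x * ln (a x) - a x * ln (b x)).
Proof.
move=> a0 b0 ba.
pose c x := b x * (resample S a x / resample S b x).
have Ec : Ex mu c = Ex mu a.
  rewrite (@Ex_resampleM S b); last first.
    by move=> x y xy; rewrite !(resample_agree _ xy).
  rewrite -(Ex_resample S a); apply: eq_Ex => x mx.
  have [bx|bx] := eqVneq (resample S b x) 0; last by field.
  rewrite bx mul0r; apply/esym.
  rewrite /resample big1 ?mul0r // => y xy.
  have [my|my] := eqVneq (mu y) 0; first by rewrite my mul0r.
  have {}my : 0 < mu y by rewrite lt0r my mu_ge0.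
  rewrite ba ?mulr0 //; apply: (@resample_eq0 S) => //.
  by rewrite -(resample_agree _ xy).
rewrite [leLHS](_ : _ = Ex mu (fun x =>
    a x * (ln (resample S a x) - ln (resample S b x)))); last first.
  rewrite (@Ex_resampleM S a
    (fun x => ln (resample S a x) - ln (resample S b x))); last first.
    by move=> x y xy; rewrite !(resample_agree _ xy).
  by apply: eq_Ex => x _; rewrite mulrBr.
rewrite -subr_ge0 -ExB -(subrr (Ex mu a)) -[X in _ - X]Ec -ExB.
apply: le_Ex => x mx; have [ax|ax] := eqVneq (a x) 0.
  rewrite ax !mul0r subrr subr0 sub0r oppr_le0.
  by rewrite mulr_ge0 // divr_ge0 // resample_ge0.
have ap : 0 < a x by rewrite lt0r ax a0.
have bp : 0 < b x by rewrite lt0r b0 andbT; apply: contra ax => /eqP/ba->.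
have rap : 0 < resample S a x.
  rewrite lt0r resample_ge0 // andbT; apply: contra ax => /eqP.
  by move=> /resample_eq0 ->.
have rbp : 0 < resample S b x.
  rewrite lt0r resample_ge0 // andbT; apply: contra (lt0r_neq0 bp) => /eqP.
  by move=> /resample_eq0 ->.
have cp : 0 < c x by rewrite mulr_gt0 // divr_gt0.
have h : a x - c x <= a x * ln (a x) - a x * ln (c x).
  by apply: xlnx_sub_ge; rewrite ?ltW // => e; rewrite e ltxx in cp.
apply: le_trans h _.
have -> : ln (c x) = ln (b x) + (ln (resample S a x) - ln (resample S b x)).
  rewrite /c; move: (resample S a x) (resample S b x) rap rbp => A B Ap Bp.
  by rewrite lnM ?posrE ?divr_gt0 // ln_div ?posrE.
by lra.
Qed.

End Resampling.

(** * Blocks without edges between them *)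

Section Markov.
Variables (R : realType) (V : finType) (q : nat).
Local Notation conf := {ffun V -> 'I_q}.
Variable mu : conf -> R.
Hypothesis mu_ge0 : forall x, 0 <= mu x.
Implicit Types (S T A B : {set V}) (x y z : conf) (f g k a b : conf -> R).

Definition splice A x y : conf := [ffun v => if v \in A then y v else x v].

(** An algebraic form of the independence of A and B given the other spins, that
    makes sense for configurations of probability zero. *)
Definition four_point A B := forall x y,
  mu x * mu (splice (A :|: B) x y) = mu (splice A x y) * mu (splice B x y).

Lemma agree_off_splice A x y : agree_off A x (splice A x y).
Proof. by apply/agree_offP => v /negbTE vA; rewrite ffunE vA. Qed.

Lemma splice_id A x y : agree_off A x y -> splice A x y = y.
Proof.
move=> /agree_offP h; apply/ffunP => v; rewrite ffunE.
by case: ifPn => // /h.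
Qed.

Lemma four_point_sym A B : four_point A B -> four_point B A.
Proof. by move=> h x y; rewrite setUC h mulrC. Qed.

Lemma four_point_swap A B x y z : [disjoint A & B] -> four_point A B ->
  agree_off A x y -> agree_off B y z -> mu x * mu z = mu y * mu (splice B x z).
Proof.
move=> dAB sep /agree_offP xy /agree_offP yz; have := sep x z.
have -> : splice (A :|: B) x z = z.
  apply/ffunP => v; rewrite ffunE inE; case: (boolP (v \in A)) => //= vA.
  by case: (boolP (v \in B)) => //= vB; rewrite xy // yz.
suff -> : splice A x z = y by [].
apply/ffunP => v; rewrite ffunE; case: ifPn => vA; last exact: xy.
by rewrite yz //; apply: contraTN vA => vB; rewrite (disjointFl dAB vB).
Qed.

Lemma four_point_sum A B x y g : [disjoint A & B] -> four_point A B ->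
  agree_off A x y ->
  mu x * \sum_(z | agree_off B y z) mu z * g z =
  mu y * \sum_(z | agree_off B x z) mu z * g (splice B y z).
Proof.
move=> dAB sep xy; rewrite !mulr_sumr.
rewrite (reindex_onto (splice B y) (splice B x)) /=; last first.
  move=> z yz; apply/ffunP => v; rewrite !ffunE; case: (boolP (v \in B)) => // vB.
  by move/agree_offP: yz => ->.
apply: eq_big => [z|z /andP[_ /eqP zE]].
  rewrite agree_off_splice /=.
  apply/eqP/idP => [<-|/splice_id e]; first exact: agree_off_splice.
  rewrite -[RHS]e; apply/ffunP => v; rewrite !ffunE; by case: (v \in B).
rewrite [LHS]mulrA [RHS]mulrA; congr (_ * _).
by rewrite -[in RHS]zE; exact: four_point_swap dAB sep xy (agree_off_splice _ _ _).
Qed.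

Lemma sum_agree_offU A B x (F : conf -> R) : [disjoint A & B] ->
  \sum_(z | agree_off (A :|: B) x z) F z =
  \sum_(y | agree_off A x y) \sum_(z | agree_off B y z) F z.
Proof.
move=> dAB; rewrite (partition_big (splice A x) (agree_off A x)) /=; last first.
  by move=> z _; exact: agree_off_splice.
apply: eq_bigr => y /agree_offP xy; apply: eq_bigl => z.
apply/andP/idP => [[/agree_offP xz /eqP <-]|/agree_offP yz].
  apply/agree_offP => v vB; rewrite ffunE; case: ifPn => // vA.
  by apply: xz; rewrite inE negb_or vA.
split; last first.
  apply/eqP/ffunP => v; rewrite ffunE; case: ifPn => vA; last exact: xy.
  by rewrite yz //; apply: contraTN vA => vB; rewrite (disjointFl dAB vB).
by apply/agree_offP => v; rewrite inE negb_or => /andP[vA vB]; rewrite xy // yz.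
Qed.

(** If y differs from x on A only, the four-point identity says that the law on B
    given the other spins is the same at x and at y; so resampling B and then A
    is resampling both. *)
Lemma four_point_resample A B g x : [disjoint A & B] -> four_point A B ->
  0 < mu x -> resample mu A (resample mu B g) x = resample mu (A :|: B) g x.
Proof.
move=> dAB sep mx.
have massB y : agree_off A x y -> mu x * mass mu B y = mu y * mass mu B x.
  move=> xy; have := four_point_sum (fun=> 1) dAB sep xy.
  by under eq_bigr do rewrite mulr1; under [in RHS]eq_bigr do rewrite mulr1.
have mBx := mass_gt0 mu_ge0 B mx.
have key (k : conf -> R) : \sum_(y | agree_off A x y) mu y * resample mu B k y =
    mu x / mass mu B x * \sum_(z | agree_off (A :|: B) x z) mu z * k z.
  rewrite sum_agree_offU // mulr_sumr; apply: eq_bigr => y xy.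
  have [my|my] := eqVneq (mu y) 0.
    rewrite my mul0r big1 ?mulr0 // => z yz.
    have /eqP := four_point_swap dAB sep xy yz.
    by rewrite my mul0r mulf_eq0 gt_eqF //= => /eqP ->; rewrite mul0r.
  have {}my : 0 < mu y by rewrite lt0r my mu_ge0.
  have mBy := mass_gt0 mu_ge0 B my.
  rewrite /resample; have := massB y xy.
  move: (mass mu B x) (mass mu B y) mBx mBy => m n m0 n0 e.
  have -> : mu y = mu x * n / m by rewrite e; field; exact: lt0r_neq0.
  by field; rewrite !lt0r_neq0.
have mAB := mass_gt0 mu_ge0 (A :|: B) mx.
have mA := mass_gt0 mu_ge0 A mx.
have massA : mass mu A x = mu x / mass mu B x * mass mu (A :|: B) x.
  have := key (fun=> 1); rewrite [in RHS](eq_bigr mu) => [<-|z _]; last first.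
    by rewrite mulr1.
  apply: eq_bigr => y xy; have [my|my] := eqVneq (mu y) 0.
    by rewrite my mul0r.
  by rewrite resample_cst ?mulr1 // lt0r my mu_ge0.
rewrite /resample key massA; move: mBx mAB.
move: (mass mu B x) (mass mu _ x) (\sum_(y | _) _) => m n s m0 n0.
by field; rewrite !lt0r_neq0.
Qed.

(** The chain rule for independent blocks: once A has been averaged out, only B is
    left to resample. *)
Lemma block_ent_four_point A B f : [disjoint A & B] -> four_point A B ->
  block_ent mu (A :|: B) f = block_ent mu A f + block_ent mu B (resample mu A f).
Proof.
move=> dAB sep; rewrite (block_ent_chain mu_ge0 _ (subsetUl A B)).
congr (_ + _); congr (_ - _); apply: eq_Ex => // x mx.
rewrite [in RHS](four_point_resample _ _ _ mx); first last.
- exact: four_point_sym.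
- by rewrite disjoint_sym.
by rewrite (resample_resample mu_ge0) ?subsetUl // setUC.
Qed.

(** Averaging over an independent block decreases entropy.  By commutation of the
    two resamplings this is the decrease of the relative entropy of f with
    respect to its resampling on B. *)
Lemma block_ent_resample_le A B f : [disjoint A & B] -> four_point A B ->
  (forall x, 0 <= f x) ->
  block_ent mu B (resample mu A f) <= block_ent mu B f.
Proof.
move=> dAB sep f0; rewrite !(block_entE mu_ge0).
have rf0 S x : 0 <= resample mu S f x by exact: resample_ge0.
apply: le_trans (@relative_entropy_resample _ _ _ _ mu_ge0 A _ _ f0 (rf0 B) _).
  apply: le_Ex => // x mx; rewrite (four_point_resample _ _ _ mx) //.
    by rewrite setUC four_point_resample.
  by rewrite disjoint_sym.
  exact: four_point_sym.
by move=> x mx; exact: resample_eq0.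
Qed.
End Markov.

(** * Quadratic forms and eigenvalues *)

Section Spectral.
Local Open Scope complex_scope.
Variables (R : realType) (n : nat) (A : 'M[R]_n) (eta : R).
Hypothesis A_sym : A^T = A.
Hypothesis A_eigen : forall a, eigenvalue A a -> a <= eta.

(** The spectral theorem holds over the complex numbers; the eigenvalues of the
    complexified symmetric matrix are real and are roots of the real
    characteristic polynomial, so the hypothesis on real eigenvalues covers all
    of them. *)
Lemma quadratic_form_le_eigenvalue (v : 'rV[R]_n) :
  (v *m A *m v^T) 0 0 <= eta * (v *m v^T) 0 0.
Proof.
pose toC := real_complex R.
pose Ac := map_mx toC A; pose vc := map_mx toC v.
have herm : Ac \is hermsymmx.
  apply: realsym_hermsym.
    apply/is_hermitianmxP; rewrite expr0 scale1r map_mx_id // /Ac.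
    by rewrite map_trmx A_sym.
  by apply/mxOverP => i j; rewrite mxE; apply/complex_realP; eexists.
have := hermitian_normalmx herm => /orthomx_spectralP AE.
have Dreal := hermitian_spectral_diag_real herm.
have Pun := spectral_unitarymx Ac.
set P := spectralmx Ac in AE Pun; set D := spectral_diag Ac in AE Dreal.
have Pinv := invmx_unitary Pun.
pose w := vc *m invmx P.
have wP : w *m P = vc by rewrite mulmxKV // unitarymx_unit.
have vcr : map_mx Num.conj vc = vc.
  by apply/matrixP => i j; rewrite !mxE; exact: conjc_real.
have wt : P *m vc^T = map_mx Num.conj w^T.
  rewrite /w Pinv trmx_mul map_mxM /= -[map_mx _ vc^T]map_trmx vcr.
  rewrite [(map_mx _ _)^T]map_trmx trmxK -map_mx_comp map_mx_id //.
  exact: conjCK.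
have D_le i : D 0 i <= toC eta.
  have /complex_realP[d dE] := mxOverP Dreal 0 i.
  rewrite dE lecR; apply: A_eigen.
  rewrite eigenvalue_root_char -(fmorph_root toC) map_char_poly.
  rewrite -eigenvalue_root_char.
  suff : eigenvalue Ac (D 0 i) by rewrite dE.
  apply/eigenvalueP.
  exists (row i P).
    rewrite -row_mul AE !mulmxA mulmxV ?unitarymx_unit // mul1mx.
    by rewrite row_mul row_diag_mx -scalemxAl -rowE.
  apply: contraTneq (unitarymx_unit Pun) => r0.
  rewrite unitmxE; suff -> : \det P = 0 by rewrite unitr0.
  by apply/eqP/det0P; exists (delta_mx 0 i); rewrite -?rowE //;
     apply/eqP => /matrixP/(_ 0 i); rewrite !mxE !eqxx => /eqP; rewrite oner_eq0.
suff : toC ((v *m A *m v^T) 0 0) <= toC eta * toC ((v *m v^T) 0 0).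
  by rewrite -rmorphM lecR.
have -> : toC ((v *m A *m v^T) 0 0) = \sum_i D 0 i * (w 0 i * (w 0 i)^*).
  have -> : toC ((v *m A *m v^T) 0 0) = (vc *m Ac *m vc^T) 0 0.
    by rewrite /vc /Ac map_trmx -!map_mxM [RHS]mxE.
  rewrite AE -!mulmxA wt mulmxA -/w mulmxA mxE; apply: eq_bigr => i _.
  by rewrite mul_mx_diag !mxE mulrAC mulrC.
have -> : toC ((v *m v^T) 0 0) = \sum_i w 0 i * (w 0 i)^*.
  have -> : toC ((v *m v^T) 0 0) = (vc *m vc^T) 0 0.
    by rewrite /vc map_trmx -!map_mxM [RHS]mxE.
  rewrite -{1}wP -mulmxA wt mxE; apply: eq_bigr => i _.
  by rewrite !mxE.
rewrite mulr_sumr; apply: ler_sum => i _; apply: ler_wpM2r => //.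
exact: mul_conjC_ge0.
Qed.
End Spectral.

(** * Spectral independence controls the removal of a site *)

Section LocalToGlobal.
Variables (R : realType) (V : finType) (q : nat).
Local Notation conf := {ffun V -> 'I_q}.
Variable mu : conf -> R.
Hypothesis mu_ge0 : forall x, 0 <= mu x.
Implicit Types (S T A B : {set V}) (x y z : conf) (u v : V).

Definition site_bounded (b : R) := forall S v x,
  v \in S -> 0 < mu x -> b * mass mu S x <= mass mu (S :\ v) x.

(** The quadratic-form content of spectral independence: the pinning is given by
    the spins of x outside S, and only centered functions of single spins are
    tested, because for these the rank-one part of the influence matrix
    disappears. *)
Definition covariance_bounded (eta : R) :=
  forall S x (phi : V -> 'I_q -> R), 0 < mu x ->
  (forall u, u \in S -> resample mu S (fun y => phi u (y u)) x = 0) ->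
  \sum_(u in S) \sum_(v in S :\ u)
     resample mu S (fun y => phi u (y u) * phi v (y v)) x
  <= eta * \sum_(u in S) resample mu S (fun y => phi u (y u) ^+ 2) x.

Lemma cards_remove S u : u \in S -> #|S :\ u|%:R = #|S|%:R - 1 :> R.
Proof. by move=> uS; rewrite (cardsD1 u S) uS natrD addrAC subrr add0r. Qed.

Lemma sum_second_difference (h : {set V} -> R) S (s : R := #|S|%:R) :
  \sum_(u in S) \sum_(v in S :\ u)
    (h (S :\ u) + h (S :\ v) - h S - h (S :\ u :\ v)) =
  2 * (s - 1) * (\sum_(u in S) h (S :\ u)) - s * (s - 1) * h S -
    \sum_(u in S) \sum_(v in S :\ u) h (S :\ u :\ v).
Proof.
under eq_bigr => u uS do rewrite !sumrB big_split /=.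
rewrite !sumrB big_split /=; congr (_ - _ - _); last first.
  under eq_bigr => u uS do rewrite sumr_const -[_ *+ _]mulr_natl cards_remove //.
  by rewrite sumr_const -[RHS]mulrA -[LHS]mulr_natl.
have e1 : \sum_(u in S) \sum_(v in S :\ u) h (S :\ u) =
    (s - 1) * \sum_(u in S) h (S :\ u).
  rewrite mulr_sumr; apply: eq_bigr => u uS.
  by rewrite sumr_const -mulr_natl cards_remove.
have e2 : \sum_(u in S) \sum_(v in S :\ u) h (S :\ v) =
    (s - 1) * \sum_(u in S) h (S :\ u).
  rewrite -e1 (exchange_big_dep (mem S)) /=; last first.
    by move=> u v uS; rewrite inE => /andP[].
  apply: eq_bigr => v vS; apply: eq_bigl => u.
  by rewrite !inE vS andbT eq_sym andbC.
by rewrite e1 e2; ring.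
Qed.

Section Local.
Variables (eta b : R).
Hypotheses (eta_gt0 : 0 < eta) (b_gt0 : 0 < b).
Hypotheses (mu_bounded : site_bounded b) (mu_cov : covariance_bounded eta).
Variable f : conf -> R.
Hypothesis f_ge0 : forall x, 0 <= f x.
Let F S := resample mu S f.
Let H S := Ex mu (fun x => F S x * ln (F S x)).

Let F_ge0 S x : 0 <= F S x. Proof. exact: resample_ge0. Qed.
Let F_agree S T x y : S \subset T -> agree_off S x y -> F T x = F T y.
Proof. by move=> ST h; apply: resample_agree; exact: agree_off_sub h. Qed.
Let resampleF S T x : T \subset S -> resample mu S (F T) x = F S x.
Proof. by move=> TS; rewrite /F resample_resample. Qed.
Let ExF S : Ex mu (F S) = Ex mu f. Proof. exact: Ex_resample. Qed.
(* Since f is nonnegative, a zero conditional mean forces zeros inside. *)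
Let F_eq0 S T x : T \subset S -> 0 < mu x -> F S x = 0 -> F T x = 0.
Proof.
by move=> TS mx; rewrite -(resampleF x TS); apply: resample_eq0.
Qed.

(** With a the conditional mean of f outside S - u - v, and c the product of the
    means for S - u and S - v divided by the mean for S, the second difference
    is the expectation of a ln a - a ln c. *)
Lemma ent_second_difference_ge S u v : u \in S -> v \in S :\ u ->
  Ex mu f - Ex mu (fun x => F (S :\ u) x * F (S :\ v) x / F S x) <=
  H (S :\ u :\ v) + H S - H (S :\ u) - H (S :\ v).
Proof.
move=> uS vSu; have vS : v \in S by move: vSu; rewrite inE => /andP[].
set w := S :\ u :\ v.
have wu : w \subset S :\ u by exact: subsetDl.
have wv : w \subset S :\ v
  by apply/subsetP => z; rewrite !inE => /and3P[-> _ ->].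
have wS : w \subset S := subset_trans wu (subsetDl _ _).
have key T : w \subset T -> H T = Ex mu (fun x => F w x * ln (F T x)).
  move=> wT; rewrite (@Ex_resampleM _ _ _ mu mu_ge0 T (F w)); last first.
    by move=> x y xy; congr ln; apply: F_agree xy.
  by apply: eq_bigr => x _; rewrite resampleF.
rewrite (key S) // (key (S :\ u)) // (key (S :\ v)) // /H.
rewrite -[X in X - _ <= _](ExF w) -ExD -!ExB; apply: le_Ex => // x mx.
have := @xlnx_sub_ge R (F w x) (F (S :\ u) x * F (S :\ v) x / F S x) (F_ge0 _ _).
have [c0|c0] := eqVneq (F S x) 0.
  by rewrite c0 (F_eq0 wS mx c0) !(mul0r, mulr0, invr0) ?subr0 ?addr0 => _.
have cp : 0 < F S x by rewrite lt0r c0 F_ge0.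
have [a0|a0] := eqVneq (F w x) 0.
  move=> _; rewrite a0 !mul0r !subr0 addr0 sub0r oppr_le0.
  by apply: divr_ge0 => //; exact: mulr_ge0.
have up : 0 < F (S :\ u) x.
  by rewrite lt0r F_ge0 andbT; apply: contra a0 => /eqP /(F_eq0 wu mx) ->.
have vp : 0 < F (S :\ v) x.
  by rewrite lt0r F_ge0 andbT; apply: contra a0 => /eqP /(F_eq0 wv mx) ->.
have rp : 0 < F (S :\ u) x * F (S :\ v) x / F S x by apply: divr_gt0 => //; exact: mulr_gt0.
move=> /(_ (ltW rp)) h; apply: le_trans (h _) _.
  by move=> e; rewrite e ltxx in rp.
move: (F w x) (F S x) (F (S :\ u) x) (F (S :\ v) x) cp up vp => a c p s c0' p0 s0.
by rewrite ln_div ?posrE ?mulr_gt0 // lnM ?posrE //; lra.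
Qed.

Lemma F_le S u x : u \in S -> 0 < mu x -> b * F (S :\ u) x <= F S x.
Proof.
move=> uS mx; have mS := mass_gt0 mu_ge0 S mx.
have mSu := mass_gt0 mu_ge0 (S :\ u) mx.
have hb := mu_bounded uS mx.
have le1 : \sum_(y | agree_off (S :\ u) x y) mu y * f y <=
           \sum_(y | agree_off S x y) mu y * f y.
  rewrite [leRHS](bigID (agree_off (S :\ u) x)) /=.
  rewrite [X in _ <= X + _](eq_bigl (agree_off (S :\ u) x)); last first.
    move=> y; case h: (agree_off (S :\ u) x y); rewrite ?andbF // andbT.
    exact: agree_off_sub (subsetDl _ _) h.
  by rewrite lerDl; apply: sumr_ge0 => y _; rewrite mulr_ge0.
have s0 : 0 <= \sum_(y | agree_off (S :\ u) x y) mu y * f y.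
  by apply: sumr_ge0 => y _; rewrite mulr_ge0.
rewrite /F /resample; move: s0 le1 mS mSu hb.
move: (\sum_(y | agree_off (S :\ u) x y) _) (\sum_(y | agree_off S x y) _).
move: (mass mu S x) (mass mu (S :\ u) x) => M m p P p0 pP M0 m0 bMm.
rewrite ler_pdivlMr //.
have -> : b * (p / m) * M = b * M / m * p by ring.
apply: le_trans pP; apply: ler_piMl => //.
by rewrite ler_pdivrMr // mul1r.
Qed.

Lemma site_bounded_le1 S u x : u \in S -> 0 < mu x -> b <= 1.
Proof.
move=> uS mx; have mS := mass_gt0 mu_ge0 S mx.
rewrite -(ler_pM2r mS) mul1r; apply: le_trans (mu_bounded uS mx) _.
by apply: mass_sub => //; exact: subsetDl.
Qed.

(** The mean for S - u is at most the mean for S divided by b, since the pinned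
    spin at u has conditional probability at least b.  This is the range in
    which the quadratic lower bound on the divergence is used. *)
Lemma chi2_le_ent S u : u \in S ->
  Ex mu (fun x => (F (S :\ u) x - F S x) ^+ 2 / F S x) <=
  2 / b * (H (S :\ u) - H S).
Proof.
move=> uS; have sub : S :\ u \subset S by exact: subsetDl.
have -> : H (S :\ u) - H S = Ex mu (fun x =>
    F (S :\ u) x * ln (F (S :\ u) x) - F (S :\ u) x * ln (F S x)
    - F (S :\ u) x + F S x).
  rewrite ExD !ExB !ExF subrK; congr (_ - _).
  rewrite [RHS](@Ex_resampleM _ _ _ mu mu_ge0 S (F _)); last first.
    by move=> x y xy; congr ln; apply: F_agree xy.
  by apply: eq_bigr => x _; rewrite resampleF.
rewrite -ExZ; apply: le_Ex => // x mx.
have [c0|c0] := eqVneq (F S x) 0.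
  by rewrite c0 (F_eq0 sub mx c0) !(mul0r, mulr0, invr0, subr0, addr0).
have cp : 0 < F S x by rewrite lt0r c0 F_ge0.
have b1 := site_bounded_le1 uS mx.
have hx : 0 <= F (S :\ u) x <= F S x / b.
  by rewrite F_ge0 /= ler_pdivlMr // mulrC F_le.
have hc : 0 < F S x <= F S x / b.
  by rewrite cp /= ler_pdivlMr // ler_piMr // ltW.
have h := xlnx_sub_ge_quad hx hc.
have b2 : 0 <= 2 / b by rewrite divr_ge0 ?ltW.
apply: le_trans (ler_wpM2l b2 h).
rewrite le_eqVlt; apply/orP; left; apply/eqP; field.
by rewrite c0 gt_eqF.
Qed.

(** Given the spins outside S, the mean for S - u is a function of the spin at u
    alone; centered by the mean for S, these functions are the ones to which the
    covariance bound applies. *)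
Lemma cov_le_chi2 S :
  \sum_(u in S) \sum_(v in S :\ u)
    (Ex mu (fun x => F (S :\ u) x * F (S :\ v) x / F S x) - Ex mu f) <=
  eta * \sum_(u in S) Ex mu (fun x => (F (S :\ u) x - F S x) ^+ 2 / F S x).
Proof.
pose upd x u (s : 'I_q) : conf := [ffun w => if w == u then s else x w].
have updE x y u : agree_off S x y -> F (S :\ u) (upd x u (y u)) = F (S :\ u) y.
  move=> /agree_offP xy; apply: resample_agree; apply/agree_offP => w.
  rewrite !inE negb_and negbK ffunE; case: eqP => [-> //|_ /= wS].
  exact: xy.
have divS (g : conf -> R) : Ex mu (fun x => g x / F S x) =
    Ex mu (fun x => resample mu S g x / F S x).
  by rewrite (@Ex_resampleM _ _ _ mu mu_ge0 S) // => x y xy; rewrite (F_agree _ xy).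
under eq_bigr => u uS do under eq_bigr => v vS do rewrite divS -(ExF S) -ExB.
under [in leRHS]eq_bigr => u uS do rewrite divS.
under eq_bigr => u uS do rewrite -Ex_sum.
rewrite -!Ex_sum -ExZ; apply: le_Ex => // x mx.
have [c0|c0] := eqVneq (F S x) 0.
  rewrite c0 !big1 ?mulr0 // => u uS; rewrite ?invr0 ?mulr0 // big1 // => v vS.
  by rewrite mulr0 subr0.
have cp : 0 < F S x by rewrite lt0r c0 F_ge0.
pose phi u s := F (S :\ u) (upd x u s) - F S x.
have phiE u y : agree_off S x y -> phi u (y u) = F (S :\ u) y - F S x.
  by move=> xy; rewrite /phi updE.
have phi0 u : u \in S -> resample mu S (fun y => phi u (y u)) x = 0.
  move=> uS; rewrite (@eq_resample _ _ _ mu mu_ge0 _ _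
    (fun y => F (S :\ u) y - F S x)); last by move=> y xy _; rewrite phiE.
  by rewrite resampleB resampleF ?subsetDl // resample_cst // subrr.
have := mu_cov mx phi0; rewrite -(ler_pM2r (ltr_wpDr (le_refl 0) (_ : 0 < (F S x)^-1))); last first.
  by rewrite invr_gt0.
rewrite addr0 => h; apply: le_trans (le_trans _ h) _.
  rewrite mulr_suml; apply: ler_sum => u uS; rewrite mulr_suml.
  apply: ler_sum => v vS; rewrite le_eqVlt; apply/orP; left; apply/eqP.
  have vSS : v \in S by move: vS; rewrite inE => /andP[].
  have [k kE] : exists k, k = F S x * F S x by eexists.
  rewrite (@eq_resample _ _ _ mu mu_ge0 _ (fun y => phi u (y u) * phi v (y v))
    (fun y => F (S :\ u) y * F (S :\ v) y - F S x * F (S :\ u) y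
      - F S x * F (S :\ v) y + k)); last first.
    by move=> y xy _; rewrite !phiE // kE; ring.
  rewrite resampleD !resampleB !resampleZ !resampleF ?subsetDl //.
  rewrite (resample_cst mu_ge0) // kE; move: (F S x) c0 => c c0; field; exact: c0.
rewrite -mulrA mulr_suml le_eqVlt; apply/orP; left; apply/eqP; congr (_ * _).
apply: eq_bigr => u uS; congr (_ / _); apply: eq_resample => // y xy my.
by rewrite phiE //  (F_agree (subxx S) xy).
Qed.

Lemma block_ent_second_difference S :
  \sum_(u in S) \sum_(v in S :\ u)
    (block_ent mu (S :\ u) f + block_ent mu (S :\ v) f - block_ent mu S f
     - block_ent mu (S :\ u :\ v) f) >=
  - (2 * eta / b) * \sum_(u in S) (block_ent mu S f - block_ent mu (S :\ u) f).
Proof.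
have HE T : block_ent mu T f = Ex mu (fun x => f x * ln (f x)) - H T by [].
have h1 : eta * \sum_(u in S) Ex mu (fun x => (F (S :\ u) x - F S x) ^+ 2 / F S x)
    <= eta * (2 / b * \sum_(u in S) (H (S :\ u) - H S)).
  apply: ler_wpM2l; first exact: ltW.
  rewrite mulr_sumr.
  by apply: ler_sum => u uS; exact: chi2_le_ent.
have h2 := le_trans (cov_le_chi2 S) h1.
rewrite mulNr lerNl; apply: le_trans (le_trans _ h2) _.
  rewrite -sumrN; apply: ler_sum => u uS; rewrite -sumrN; apply: ler_sum => v vS.
  have := ent_second_difference_ge uS vS; rewrite !HE; lra.
rewrite mulrA le_eqVlt; apply/orP; left; apply/eqP; congr (_ * _).
  by field; rewrite gt_eqF.
by apply: eq_bigr => u uS; rewrite !HE; lra.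
Qed.

(** Let H1 and H2 be the sums of h over S minus one site and over S minus an
    ordered pair.  The second-difference inequality relates h(S), H1 and H2, and
    the induction hypothesis at each S - u bounds H2 below by
    (|S| - 2 - rho) H1; eliminating H2 leaves the claim times |S|. *)
Lemma block_ent_remove_site S :
  (#|S|%:R - 1 - 2 * eta / b) * block_ent mu S f <=
  \sum_(u in S) block_ent mu (S :\ u) f.
Proof.
have [n] := ubnP #|S|; elim: n S => // n IH S; rewrite ltnS => Sn.
have [S0|Sn0] := eqVneq S set0.
  by rewrite S0 big_set0 block_ent_set0 // mulr0.
set rho := 2 * eta / b.
pose h T := block_ent mu T f; set s : R := #|S|%:R.
have sp : 0 < s by rewrite ltr0n card_gt0.
pose S1 := \sum_(u in S) h (S :\ u).
have S2 : (s - 2 - rho) * S1 <=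
    \sum_(u in S) \sum_(v in S :\ u) h (S :\ u :\ v).
  rewrite mulr_sumr; apply: ler_sum => u uS.
  have := IH (S :\ u); rewrite cards_remove // -/s.
  have -> : s - 1 - 1 = s - 2 by lra.
  by apply; rewrite (leq_trans _ Sn) // [leqRHS](cardsD1 u S) uS.
have := block_ent_second_difference S; rewrite -/rho.
have -> : \sum_(u in S) (block_ent mu S f - block_ent mu (S :\ u) f) =
    s * h S - S1.
  by rewrite sumrB sumr_const -mulr_natl.
have -> : \sum_(u in S) \sum_(v in S :\ u)
    (block_ent mu (S :\ u) f + block_ent mu (S :\ v) f - block_ent mu S f
     - block_ent mu (S :\ u :\ v) f) =
  2 * (s - 1) * S1 - s * (s - 1) * h S -
    \sum_(u in S) \sum_(v in S :\ u) h (S :\ u :\ v).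
  exact: (sum_second_difference h).
move=> hl; rewrite -/(h S) -/S1 -(ler_pM2l sp).
by move: (\sum_(u in S) \sum_(v in _) _) S2 hl => X S2 hl; nra.
Qed.
End Local.
End LocalToGlobal.

(** * Entropy of random blocks *)

Section RandomBlocks.
Variables (R : realType) (V : finType).
Implicit Types (S T C : {set V}) (p : R).

Definition bernoulli p S : R := p ^+ #|S| * (1 - p) ^+ #|~: S|.

Lemma bernoulli_ge0 p S : 0 <= p <= 1 -> 0 <= bernoulli p S.
Proof.
by move=> /andP[p0 p1]; rewrite mulr_ge0 // exprn_ge0 // subr_ge0.
Qed.

Lemma bernoulliE p S :
  bernoulli p S = \prod_v (if v \in S then p else 1 - p).
Proof.
rewrite (bigID (mem S)) /= (eq_bigr (fun=> p)); last by move=> v ->.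
rewrite [X in _ * X](eq_bigr (fun=> 1 - p)); last by move=> v /negbTE ->.
rewrite !prodr_const; congr (_ * _ ^+ _).
by apply: eq_card => v; rewrite !inE.
Qed.

Lemma sum_bernoulli p : \sum_S bernoulli p S = 1.
Proof.
under eq_bigr do rewrite bernoulliE.
rewrite -(bigA_distr _ _ (fun=> p) (fun=> 1 - p)) /=.
by rewrite big1 // => v _; rewrite addrC subrK.
Qed.

Variables (h : {set V} -> R) (rho : R) (r : nat).
Hypotheses (h_ge0 : forall S, 0 <= h S) (rho_le : rho <= r%:R).
Hypothesis h_remove : forall S,
  (#|S|%:R - 1 - rho) * h S <= \sum_(u in S) h (S :\ u).

Let B (m : nat) := \sum_(S : {set V} | #|S| == m) h S.

(* Count the pairs of a block of size m + 1 and one of its sites by the block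
   that remains when the site is removed. *)
Let B_step m : (r <= m)%N -> (m < #|V|)%N ->
  (m - r)%:R * B m.+1 <= (#|V| - m)%:R * B m.
Proof.
move=> rm mV.
apply: (@le_trans _ _ (\sum_(S : {set V} | #|S| == m.+1) \sum_(u in S) h (S :\ u))).
  rewrite mulr_sumr; apply: ler_sum => S /eqP Sm.
  apply: le_trans (h_remove S); apply: ler_wpM2r => //.
  by rewrite Sm natrB // -natr1 addrK lerD2l lerN2.
rewrite (exchange_big_dep xpredT) //=.
have -> : \sum_u \sum_(S : {set V} | (#|S| == m.+1) && (u \in S)) h (S :\ u) =
          \sum_u \sum_(S : {set V} | (#|S| == m) && (u \notin S)) h S.
  apply: eq_bigr => u _.
  rewrite (reindex_onto (fun S => u |: S) (fun S => S :\ u)) /=; last first.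
    by move=> S /andP[_ uS]; exact: setD1K.
  apply: eq_big => [S|S /andP[_ /eqP ->] //].
  rewrite setU11 andbT; case: (boolP (u \in S)) => uS.
    rewrite andbF; apply/negbTE; rewrite negb_and; apply/orP; right.
    by apply: contraTneq uS => <-; rewrite !inE eqxx.
  by rewrite cardsU1 uS setU1K // eqxx andbT.
rewrite (exchange_big_dep (fun S => #|S| == m)) /=; last by move=> ? ? _ /andP[].
rewrite mulr_sumr; apply: ler_sum => S /eqP Sm.
rewrite Sm eqxx /= sumr_const -[leLHS]mulr_natl le_eqVlt; apply/orP; left.
have -> : #|[pred u | u \notin S]| = (#|V| - m)%N.
  rewrite -Sm -[S in RHS]setCK -cardsCs; apply: eq_card => u; by rewrite !inE.
by [].
Qed.

Let B_top : B #|V| = h setT.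
Proof.
rewrite /B (big_pred1 setT) // => S; rewrite -cardsT eq_sym.
apply/eqP/eqP => [e|-> //]; apply/eqP; rewrite eqEcard subsetT.
by rewrite e leqnn.
Qed.

(* For rho = r the function counting the (r+1)-subsets of a block turns the
   hypothesis on h into an equality; these binomial coefficients are its
   level sums, divided by its value at V. *)
Let B_ge j : (j <= #|V| - r.+1)%N -> (r < #|V|)%N ->
  'C(#|V| - r.+1, j)%:R * h setT <= B (#|V| - j)%N.
Proof.
move=> + rV; elim: j => [|j IH] jN; first by rewrite bin0 mul1r subn0 B_top.
have {}IH := IH (ltnW jN).
have jV : (j < #|V|)%N by rewrite (leq_trans jN) // leq_subr.
set m := (#|V| - j.+1)%N; have mE : (#|V| - j)%N = m.+1 by rewrite /m subnSK.
have rm : (r <= m)%N by rewrite /m; lia.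
have mV : (m < #|V|)%N by rewrite /m; lia.
have := B_step rm mV; rewrite -mE.
have -> : (#|V| - m)%N = j.+1 by rewrite /m; lia.
have -> : (m - r)%N = (#|V| - r.+1 - j)%N by rewrite /m; lia.
move=> st; rewrite -(@ler_pM2l _ j.+1%:R) ?ltr0n //.
apply: le_trans st; rewrite mulrA -natrM mul_bin_left natrM -mulrA.
by apply: ler_wpM2l.
Qed.

(** The lower bounds on the level sums of h are the terms of the expansion of
    p^(r+1) (p + (1 - p))^N with N = |V| - r - 1. *)
Lemma bernoulli_sum_ge p : 0 <= p <= 1 ->
  p ^+ r.+1 * h setT <= \sum_S bernoulli p S * h S.
Proof.
move=> p01; have [p0 p1] := andP p01.
have [rV|Vr] := ltnP r #|V|; last first.
  rewrite (bigD1 setT) //= -[leLHS]addr0; apply: lerD; last first.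
    by apply: sumr_ge0 => S _; rewrite mulr_ge0 // bernoulli_ge0.
  rewrite /bernoulli setCT cards0 expr0 mulr1 cardsT; apply: ler_wpM2r => //.
  by apply: ler_wiXn2l => //; exact: leqW.
set N := (#|V| - r.+1)%N.
apply: (@le_trans _ _ (\sum_(j < N.+1) \sum_(S : {set V} | #|S| == (#|V| - j)%N)
   bernoulli p S * h S)); last first.
  rewrite (exchange_big_dep xpredT) //=; apply: ler_sum => S _.
  rewrite sumr_const -[leLHS]mulr_natr; apply: ler_piMr.
    by rewrite mulr_ge0 // bernoulli_ge0.
  rewrite -[leRHS]/(1%:R) ler_nat; apply/card_le1_eqP => i j.
  move=> /eqP iE /eqP jE; apply: ord_inj.
  have leV (k : 'I_N.+1) : (k <= #|V|)%N.
    by rewrite (leq_trans _ (leq_subr r.+1 #|V|)) // -ltnS.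
  by rewrite -(subKn (leV i)) -(subKn (leV j)) -iE -jE.
apply: (@le_trans _ _ (\sum_(j < N.+1) p ^+ (#|V| - j) * (1 - p) ^+ j *
    ('C(N, j)%:R * h setT))).
  under eq_bigr do rewrite mulrA; rewrite -mulr_suml; apply: ler_wpM2r => //.
  have -> : \sum_(i < N.+1) p ^+ (#|V| - i) * (1 - p) ^+ i * 'C(N, i)%:R =
      p ^+ r.+1 * (p + (1 - p)) ^+ N.
    rewrite exprDn mulr_sumr; apply: eq_bigr => j _.
    rewrite -[in RHS]mulr_natr !mulrA -exprD; congr (_ ^+ _ * _ * _).
    by have := ltn_ord j; rewrite /N; lia.
  by rewrite addrC subrK expr1n mulr1.
apply: ler_sum => j _; have jN : (j <= N)%N by rewrite -ltnS.
apply: le_trans (ler_wpM2l _ (B_ge jN rV)) _.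
  by rewrite mulr_ge0 // exprn_ge0 // subr_ge0.
rewrite /B mulr_sumr le_eqVlt; apply/orP; left; apply/eqP.
apply: eq_bigr => S /eqP SE; rewrite /bernoulli SE; congr (_ * _ ^+ _ * _).
rewrite cardsCs setCK SE; move: jN; rewrite /N; lia.
Qed.
End RandomBlocks.

(** * Tensorization with an exponential constant *)

Lemma path_dist_le (R : realType) (T : finType) (e : rel T) (f : T -> R) (d : R) :
  0 <= d -> (forall y z, e y z -> `|f y - f z| <= d) ->
  forall (A : {set T}) y z, (forall w, connect e y w -> w \in A) ->
  connect e y z -> `|f y - f z| <= d * #|A|%:R.
Proof.
move=> d0 fd A y z yA /connectP[p pth ->].
case/shortenP: pth => {}p pth un _.
apply: (@le_trans _ _ (d * (size p)%:R)).
  elim: p y pth {un yA} => [|w p IH] y /=; first by rewrite subrr normr0 mulr0.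
  move=> /andP[yw /IH hp]; rewrite -natr1 mulrDr mulr1 [_ + d]addrC.
  have -> : f y - f (last w p) = (f y - f w) + (f w - f (last w p)) by ring.
  by apply: le_trans (ler_normD _ _) _; apply: lerD => //; exact: fd.
apply: ler_wpM2l => //; rewrite ler_nat.
have : (size (y :: p) <= #|A|)%N.
  rewrite -(card_uniqP un); apply: subset_leq_card; apply/subsetP => w wp.
  by apply: yA; apply: path_connect wp.
exact: ltnW.
Qed.

(** On a class of configurations all of whose probabilities are at least
    beta = b^|C|, everything is estimated by brute force: the entropy by the
    variance, the variance by the oscillation of g, the oscillation by the sum of
    increments along a path of single-site flips, an increment by a single-site
    variance, and this variance by a single-site entropy.  Each step costs at
    most a power of 1/beta, as the class has at most 1/beta configurations. *)
Section Crude.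
Variables (R : realType) (V : finType) (q : nat).
Local Notation conf := {ffun V -> 'I_q}.
Variable mu : conf -> R.
Hypothesis mu_ge0 : forall x, 0 <= mu x.
Implicit Types (S T A B C : {set V}) (x y z : conf) (u v : V).

Definition flip C : rel conf :=
  [rel y z | [&& 0 < mu y, 0 < mu z & [exists v in C, agree_off [set v] y z]]].

Definition flip_connected := forall C x y, 0 < mu x -> 0 < mu y ->
  agree_off C x y -> connect (flip C) x y.

Variable b : R.
Hypotheses (b_gt0 : 0 < b) (mu_bounded : site_bounded mu b).
Hypothesis mu_connected : flip_connected.

Lemma mass_le_mu C x : 0 < mu x -> b ^+ #|C| * mass mu C x <= mu x.
Proof.
move=> mx; have [n] := ubnP #|C|; elim: n C => // n IH C; rewrite ltnS => Cn.
have [->|/set0Pn[v vC]] := eqVneq C set0.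
  by rewrite cards0 expr0 mul1r mass0E.
have Cv : #|C| = #|C :\ v|.+1 by rewrite (cardsD1 v C) vC.
rewrite Cv exprSr -mulrA; apply: le_trans (IH (C :\ v) _); last by rewrite -Cv.
by apply: ler_wpM2l; [rewrite exprn_ge0 // ltW | exact: mu_bounded].
Qed.

Variables (C : {set V}) (g : conf -> R) (x : conf).
Hypotheses (g_ge0 : forall y, 0 <= g y) (mx : 0 < mu x).
Let beta := b ^+ #|C|.
Let c := resample mu C g x.
Let D := \sum_(v in C)
  resample mu C (fun y => (g y - resample mu [set v] g y) ^+ 2) x.

Let beta_gt0 : 0 < beta. Proof. by rewrite exprn_gt0. Qed.
Let mass_p : 0 < mass mu C x. Proof. exact: mass_gt0. Qed.

Let mu_ge y : agree_off C x y -> 0 < mu y -> beta * mass mu C x <= mu y.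
Proof. by move=> xy my; rewrite (mass_agree mu xy); exact: mass_le_mu. Qed.

Let part_le (k : conf -> R) (A : {set conf}) : (forall y, 0 <= k y) ->
  (forall y, y \in A -> agree_off C x y && (0 < mu y)) ->
  beta * \sum_(y in A) k y <= resample mu C k x.
Proof.
move=> k0 Ax; rewrite /resample ler_pdivlMr // mulrAC mulr_sumr.
apply: (@le_trans _ _ (\sum_(y in A) mu y * k y)).
  apply: ler_sum => y /Ax/andP[xy my]; apply: ler_wpM2r => //; exact: mu_ge.
rewrite big_mkcond [leRHS]big_mkcond /=; apply: ler_sum => y _.
case: ifP => [/Ax/andP[-> _] //|_].
by case: ifP => // _; rewrite mulr_ge0.
Qed.

Let g_le y : agree_off C x y -> 0 < mu y -> g y <= c / beta.
Proof.
move=> xy my; rewrite ler_pdivlMr // mulrC.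
have := @part_le g [set y] g_ge0; rewrite big_set1; apply.
by move=> z; rewrite inE => /eqP ->; rewrite xy.
Qed.

Let support := [set y | agree_off C x y & 0 < mu y].

Let card_support : #|support|%:R <= beta^-1.
Proof.
rewrite -[beta^-1]mul1r ler_pdivlMr // mulrC.
have := @part_le (fun=> 1) support; rewrite sumr_const resample_cst //.
by apply => // y; rewrite inE.
Qed.

Let D_ge0 : 0 <= D.
Proof. by apply: sumr_ge0 => v _; apply: resample_ge0 => // y; exact: sqr_ge0. Qed.

(* Both ends of the edge contribute their squared distance from the common mean
   at v, and the sum of these is at least half the squared increment. *)
Let edge_le y z : agree_off C x y -> flip C y z ->
  `|g y - g z| <= Num.sqrt (2 * D / beta).
Proof.
move=> xy /and3P[my mz /existsP[v /andP[vC yz]]].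
have [->|yNz] := eqVneq y z; first by rewrite subrr normr0 sqrtr_ge0.
rewrite -sqrtr_sqr ler_wsqrtr // ler_pdivlMr //.
have xz : agree_off C x z.
  by apply: agree_off_trans xy (agree_off_sub _ yz); rewrite sub1set.
pose k w := (g w - resample mu [set v] g w) ^+ 2.
have kD : resample mu C k x <= D.
  rewrite /D (bigD1 v) //= lerDl; apply: sumr_ge0 => u _.
  by apply: resample_ge0 => // w; exact: sqr_ge0.
have := @part_le k [set y; z] (fun w => sqr_ge0 _).
rewrite big_setU1 ?inE //= big_set1 => h.
have {h} h : beta * (k y + k z) <= D.
  apply: le_trans kD; apply: h => w.
  by rewrite !inE => /orP[]/eqP->; rewrite ?xy ?xz.
rewrite /k (resample_agree mu g yz) in h.
move: (resample mu [set v] g z) h => t h.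
have -> : 2 * D = D * 2 by rewrite mulrC.
rewrite -ler_pdivrMr //; apply: le_trans h; rewrite mulrAC mulrC.
apply: ler_wpM2l; first exact: ltW.
rewrite -subr_ge0.
have -> : (g y - t) ^+ 2 + (g z - t) ^+ 2 - (g y - g z) ^+ 2 / 2 =
  (g y + g z - 2 * t) ^+ 2 / 2 by field.
by rewrite divr_ge0 ?sqr_ge0.
Qed.

Let diff_le y z : agree_off C x y -> 0 < mu y -> agree_off C x z -> 0 < mu z ->
  `|g y - g z| <= Num.sqrt (2 * D / beta) / beta.
Proof.
move=> xy my xz mz.
pose e := [rel y z | agree_off C x y && flip C y z].
have connE w w' : agree_off C x w -> connect (flip C) w w' -> connect e w w'.
  move=> + /connectP[p pth ->]; elim: p w pth => [|t p IH] w //=.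
  move=> /andP[wt /IH h] xw; apply: connect_trans (h _); last first.
    case/and3P: wt => _ _ /existsP[v /andP[vC wt]].
    by apply: agree_off_trans xw (agree_off_sub _ wt); rewrite sub1set.
  by apply: connect1; rewrite /= xw.
have eS w : connect e y w -> w \in support.
  move=> /connectP[p pth ->] {w}; elim: p y xy my pth => [|t p IH] y xy my /=.
    by rewrite inE xy.
  move=> /andP[/andP[_ yt]]; apply: IH; last by case/and3P: yt.
  case/and3P: yt => _ _ /existsP[v /andP[vC yt]].
  by apply: agree_off_trans xy (agree_off_sub _ yt); rewrite sub1set.
have yz : connect e y z.
  apply: connE => //; apply: mu_connected => //.
  by rewrite agree_off_sym in xy; exact: agree_off_trans xy xz.
have s0 := sqrtr_ge0 (2 * D / beta).
apply: le_trans (path_dist_le s0 _ eS yz) _.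
  by move=> w w' /andP[xw ww']; exact: edge_le.
by apply: ler_wpM2l => //; exact: card_support.
Qed.

(* The mean c lies within the oscillation of g around any of its values. *)
Let dev_le y : agree_off C x y -> 0 < mu y ->
  (g y - c) ^+ 2 <= 2 * D / beta ^+ 3.
Proof.
move=> xy my; have s0 := sqrtr_ge0 (2 * D / beta).
set s := Num.sqrt _ in s0.
have ss : s ^+ 2 = 2 * D / beta.
  by rewrite sqr_sqrtr // divr_ge0 ?mulr_ge0 // ltW.
have -> : 2 * D / beta ^+ 3 = (s / beta) ^+ 2.
  rewrite expr_div_n ss; field; exact: lt0r_neq0.
rewrite -[leLHS]real_normK ?num_real // ler_pXn2r ?nnegrE ?divr_ge0 ?(ltW beta_gt0) //.
rewrite ler_norml lerBrDr lerBlDr.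
have h z : agree_off C x z -> 0 < mu z -> `|g y - g z| <= s / beta.
  by move=> xz mz; exact: diff_le.
apply/andP; split.
  have : resample mu C g x <= resample mu C (fun=> g y + s / beta) x.
    apply: resample_le => // z xz mz; have := h z xz mz.
    by rewrite ler_norml => /andP[]; lra.
  by rewrite resample_cst // -/c; lra.
have : resample mu C (fun=> g y - s / beta) x <= resample mu C g x.
  apply: resample_le => // z xz mz; have := h z xz mz.
  by rewrite ler_norml => /andP[]; lra.
by rewrite resample_cst // -/c; lra.
Qed.

Let site_term v y := g y * ln (g y) - g y * ln (resample mu [set v] g y)
  - g y + resample mu [set v] g y.

Lemma ent_le_site_ent :
  resample mu C (fun y => g y * ln (g y) - g y * ln c - g y + c) x <=
  4 / beta ^+ 4 * \sum_(v in C) resample mu C (site_term v) x.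
Proof.
have c0 : 0 <= c by exact: resample_ge0.
have D_le : D <= 2 * c / beta * \sum_(v in C) resample mu C (site_term v) x.
  rewrite mulr_sumr; apply: ler_sum => v vC; rewrite -resampleZ.
  apply: resample_le => // y xy my; rewrite /site_term.
  have gv0 : 0 <= resample mu [set v] g y by exact: resample_ge0.
  have [gvE|gvN] := eqVneq (resample mu [set v] g y) 0.
    have gy := resample_eq0 mu_ge0 g_ge0 my gvE.
    by rewrite gvE gy !mul0r !subr0 addr0 expr0n /= mulr0.
  have gvp : 0 < resample mu [set v] g y by rewrite lt0r gvN.
  have gvc : resample mu [set v] g y <= c / beta.
    rewrite -(resample_cst mu_ge0 [set v] (c / beta) my).
    apply: resample_le => // z yz mz; apply: g_le => //.
    by apply: agree_off_trans xy (agree_off_sub _ yz); rewrite sub1set.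
  have gc := g_le xy my.
  have cb : 0 < c / beta := lt_le_trans gvp gvc.
  have hx : 0 <= g y <= c / beta by rewrite g_ge0.
  have hv : 0 < resample mu [set v] g y <= c / beta by rewrite gvp.
  have cb2 : 0 < 2 * (c / beta) by apply: mulr_gt0.
  by have := xlnx_sub_ge_quad hx hv; rewrite ler_pdivrMr // mulrC mulrA.
have [cE|cN] := eqVneq c 0.
  have gz w : agree_off C x w -> 0 < mu w -> g w = 0.
    move=> xw mw; apply/le_anti; rewrite g_ge0 andbT.
    by have := g_le xw mw; rewrite cE mul0r.
  rewrite (@eq_resample _ _ _ mu mu_ge0 _ _ (fun=> 0)); last first.
    by move=> y xy my; rewrite gz // cE !mul0r !subr0 addr0.
  rewrite resample_cst //; apply: mulr_ge0.
    by apply: divr_ge0 => //; apply: exprn_ge0; exact: ltW.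
  apply: sumr_ge0 => v vC; apply: le_trans (_ : resample mu C (fun=> 0) x <= _).
    by rewrite resample_cst.
  apply: resample_le => // y xy my; rewrite /site_term gz // !mul0r !subr0 add0r.
  exact: resample_ge0.
have cp : 0 < c by rewrite lt0r cN.
apply: (@le_trans _ _ (2 * D / beta ^+ 3 / c)).
  rewrite -(resample_cst mu_ge0 C (2 * D / beta ^+ 3 / c) mx).
  apply: resample_le => // y xy my.
  apply: (@le_trans _ _ ((g y - c) ^+ 2 / c)); last first.
    by apply: ler_wpM2r; [rewrite invr_ge0 | exact: dev_le].
  have := g_ge0 y; rewrite le0r => /orP[/eqP ->|gp].
    have -> : (0 - c) ^+ 2 / c = c by field.
    by rewrite !mul0r !subr0 add0r.
  have r0 : 0 < g y / c by rewrite divr_gt0.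
  have := @le_ln1Dx R (g y / c - 1); rewrite addrCA subrr addr0 => /(_ _) hl.
  have {}hl : ln (g y / c) <= g y / c - 1 by apply: hl; lra.
  rewrite ln_div ?posrE // in hl.
  have := ler_wpM2l (g_ge0 y) hl; rewrite mulrBr => {}hl.
  rewrite -subr_ge0; rewrite -subr_ge0 in hl; apply: le_trans hl _.
  by rewrite le_eqVlt; apply/orP; left; apply/eqP; field.
rewrite ler_pdivrMr // ler_pdivrMr ?exprn_gt0 //.
apply: (@le_trans _ _ (2 * (2 * c / beta * \sum_(v in C) resample mu C (site_term v) x))).
  by apply: ler_wpM2l.
move: (\sum_(v in C) _) => X; rewrite le_eqVlt; apply/orP; left; apply/eqP.
by field; rewrite gt_eqF.
Qed.
End Crude.

Lemma crude_entropy_tensorization (R : realType) (V : finType) (q : nat)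
    (mu : {ffun V -> 'I_q} -> R) (b : R) (C : {set V}) g :
  (forall x, 0 <= mu x) -> 0 < b -> site_bounded mu b -> flip_connected mu ->
  (forall x, 0 <= g x) ->
  block_ent mu C g <=
  4 / b ^+ (4 * #|C|) * \sum_(v in C) block_ent mu [set v] g.
Proof.
move=> mu0 b0 mb mc g0.
have entE S : block_ent mu S g = Ex mu (fun x => g x * ln (g x)
    - g x * ln (resample mu S g x) - g x + resample mu S g x).
  by rewrite ExD ExB Ex_resample // subrK (block_entE mu0).
rewrite entE -(Ex_resample mu0 C).
have -> : \sum_(v in C) block_ent mu [set v] g = Ex mu (fun x =>
    \sum_(v in C) resample mu C (fun y => g y * ln (g y)
    - g y * ln (resample mu [set v] g y) - g y + resample mu [set v] g y) x).
  by rewrite Ex_sum; apply: eq_bigr => v _; rewrite Ex_resample // entE.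
rewrite -ExZ; apply: le_Ex => // x mx.
rewrite mulnC exprM; apply: le_trans (ent_le_site_ent mu0 b0 mb mc C g0 mx).
rewrite le_eqVlt; apply/orP; left; apply/eqP; apply: eq_resample => // y xy _.
by rewrite -(resample_agree _ _ xy).
Qed.

(** * Components and percolation *)

Section Components.
Variables (V : finType) (G : sgraph V).
Implicit Types (S T A B C : {set V}) (u v w : V).

Definition nonadjacent A B := forall u v, u \in A -> v \in B -> ~~ G u v.

Lemma nonadjacent_sym A B : nonadjacent A B -> nonadjacent B A.
Proof. by move=> AB u v uB vA; rewrite (adj_sym G); exact: AB. Qed.

Lemma nonadjacentS A B A' B' : A' \subset A -> B' \subset B ->
  nonadjacent A B -> nonadjacent A' B'.
Proof. by move=> /subsetP sA /subsetP sB AB u v /sA uA /sB; exact: AB. Qed.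

Definition inner_adj S : rel V := [rel u w | [&& u \in S, w \in S & G u w]].

Definition component S v := [set w | connect (inner_adj S) v w].

Definition isolated S := [set v in S | [forall w in S, ~~ G v w]].

Lemma inner_adj_connect_sym S : connect_sym (inner_adj S).
Proof.
by apply: sym_connect_sym => u w; rewrite /inner_adj /= (adj_sym G) andbCA.
Qed.

Lemma mem_component S v : v \in component S v.
Proof. by rewrite inE connect0. Qed.

Lemma component_sub S v : v \in S -> component S v \subset S.
Proof.
move=> vS; apply/subsetP => w; rewrite inE => /connectP[p pth ->] {w}.
by elim: p v vS pth => //= w p IH v vS /andP[/and3P[_ wS _]]; exact: IH.
Qed.

Lemma component_eq S u v : u \in component S v -> component S u = component S v.
Proof.
rewrite inE => vu; apply/setP => w; rewrite !inE.
by rewrite (same_connect (inner_adj_connect_sym S) vu).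
Qed.

Lemma component_nonadjacent S v :
  v \in S -> nonadjacent (component S v) (S :\: component S v).
Proof.
move=> vS u w uC; rewrite inE => /andP[wC wS]; apply: contra wC => uw.
have uS := subsetP (component_sub vS) u uC.
rewrite inE in uC; rewrite inE; apply: connect_trans uC (connect1 _).
by rewrite /inner_adj /= uS wS.
Qed.

(** A path in S that starts in C cannot leave C. *)
Lemma component_restrict S C v : C \subset S -> nonadjacent C (S :\: C) ->
  v \in C -> component S v = component C v.
Proof.
move=> CS nCS vC; apply/setP => w; rewrite !inE; apply/idP/idP.
  move=> /connectP[p pth ->] {w}; elim: p v vC pth => [|w p IH] v vC //=.
  move=> /andP[/and3P[vS wS vw] pth].
  have wC : w \in C.
    by apply: contraTT vw => wC; apply: nCS; rewrite ?inE ?wC.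
  apply: connect_trans (IH w wC pth); apply: connect1.
  by rewrite /inner_adj /= vC wC.
apply: connect_sub => u t /and3P[uC tC ut]; apply: connect1.
by rewrite /inner_adj /= ut !(subsetP CS).
Qed.

Lemma component_isolated S v : v \in isolated S -> component S v = [set v].
Proof.
rewrite inE => /andP[vS /forall_inP iso].
rewrite (@component_restrict S [set v] v) ?inE ?sub1set //.
  apply/eqP; rewrite eqEsubset sub1set mem_component andbT.
  by apply: component_sub; rewrite inE.
by move=> u w; rewrite !inE => /eqP -> /andP[_]; exact: iso.
Qed.

Lemma isolatedU C T v : nonadjacent C T ->
  v \in T -> (v \in isolated (C :|: T)) = (v \in isolated T).
Proof.
move=> CT vT; rewrite !inE vT orbT /=; apply/forall_inP/forall_inP => iso w wS.
  by apply: iso; rewrite inE wS orbT.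
move: wS; rewrite inE => /orP[wC|]; last exact: iso.
by rewrite (adj_sym G); exact: CT.
Qed.

Definition neighbours C := [set w | (w \notin C) && [exists u in C, G u w]].

Lemma card_neighbours C : (#|neighbours C| <= max_degree G * #|C|)%N.
Proof.
have sub : neighbours C \subset \bigcup_(u in C) [set w | G u w].
  apply/subsetP => w; rewrite inE => /andP[_ /existsP[u /andP[uC uw]]].
  by apply/bigcupP; exists u; rewrite ?inE.
apply: leq_trans (subset_leq_card sub) _.
rewrite mulnC -sum_nat_const.
elim/big_rec2: _ => [|u A m uC IH]; first by rewrite cards0.
apply: leq_trans (leq_card_setU _ _) _; apply: leq_add IH.
exact: (@leq_bigmax _ (fun u => #|[set w | G u w]|)).
Qed.

Lemma component_cylinder S C v : v \in C -> component C v = C ->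
  C \subset S -> [disjoint S & neighbours C] -> component S v = C.
Proof.
move=> vC CE CS dS; rewrite (component_restrict CS) // => u w uC.
rewrite inE => /andP[wC wS]; apply/negP => uw.
have := disjointFr dS wS; rewrite inE wC => /negbT/existsPn/(_ u).
by rewrite uC uw.
Qed.
End Components.

Section Percolation.
Variables (R : realType) (V : finType) (G : sgraph V).
Implicit Types (S T A B C : {set V}) (u v w : V).

(** The product over all sites of (weight if included + weight if excluded), with
    the forbidden weights set to 0, expands into the sum over the blocks of the
    cylinder. *)
Lemma bernoulli_cylinder (p : R) A B : [disjoint A & B] ->
  \sum_(S : {set V} | (A \subset S) && [disjoint S & B]) bernoulli p S =
  p ^+ #|A| * (1 - p) ^+ #|B|.
Proof.
move=> dAB.
transitivity (\prod_v ((if v \in B then 0 else p) + (if v \in A then 0 else 1 - p))).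
  rewrite (bigA_distr _ _ (fun v => if v \in B then 0 else p)
    (fun v => if v \in A then 0 else 1 - p)) /= big_mkcond.
  apply: eq_bigr => S _; case: ifPn => [/andP[AS dS]|].
    rewrite bernoulliE; apply: eq_bigr => v _; case: ifPn => vS.
      by rewrite (disjointFr dS vS).
    by rewrite ifN //; apply: contra vS => /(subsetP AS).
  rewrite negb_and => /orP[/subsetPn[v vA vS]|].
    by apply/esym/eqP; rewrite prodf_seq_eq0; apply/hasP; exists v;
       rewrite ?mem_index_enum //= (negbTE vS) vA.
  rewrite disjoint_subset => /subsetPn[v vS]; rewrite inE negbK => vB.
  by apply/esym/eqP; rewrite prodf_seq_eq0; apply/hasP; exists v;
     rewrite ?mem_index_enum //= vS vB.
rewrite (bigID (mem A)) /= (eq_bigr (fun=> p)); last first.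
  by move=> v vA; rewrite vA (disjointFr dAB vA) addr0.
rewrite prodr_const; congr (_ * _).
rewrite (bigID (mem B)) /= (eq_bigr (fun=> 1 - p)); last first.
  by move=> v /andP[/negbTE -> ->]; rewrite add0r.
rewrite [X in _ * X]big1 ?mulr1; last first.
  by move=> v /andP[/negbTE -> /negbTE ->]; rewrite addrC subrK.
rewrite prodr_const; congr (_ ^+ _); apply: eq_card => v.
rewrite unfold_in /=; case: (boolP (v \in B)) => vB; rewrite ?andbF // andbT.
by rewrite (disjointFl dAB vB).
Qed.

(** For fixed v and distinct connected C containing v, the events that the random
    block contains C and avoids its neighbours are disjoint, because each of them
    makes C the component of v; their probabilities add up to at most 1. *)
Lemma sum_connected_sets (p : R) v : 0 <= p <= 1 ->
  \sum_(C : {set V} | (v \in C) && (component G C v == C))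
    (p * (1 - p) ^+ max_degree G) ^+ #|C| <= 1.
Proof.
move=> p01; have /andP[p0 p1] := p01; have q0 : 0 <= 1 - p by rewrite subr_ge0.
pose cyl C S := (C \subset S) && [disjoint S & neighbours G C].
apply: (@le_trans _ _ (\sum_(C : {set V} | (v \in C) && (component G C v == C))
   \sum_(S | cyl C S) bernoulli p S)).
  apply: ler_sum => C _; rewrite bernoulli_cylinder; last first.
    by rewrite disjoint_subset; apply/subsetP => u uC; rewrite !inE uC.
  rewrite exprMn -exprM; apply: ler_wpM2l; first exact: exprn_ge0.
  apply: ler_wiXn2l => //; last exact: card_neighbours.
  by rewrite lerBlDr lerDl.
rewrite (exchange_big_dep xpredT) //= -(sum_bernoulli V p).
apply: ler_sum => S _; rewrite sumr_const -[leLHS]mulr_natr; apply: ler_piMr.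
  exact: bernoulli_ge0.
rewrite -[leRHS]/(1%:R) ler_nat; apply/card_le1_eqP => C C'.
move=> /andP[/andP[vC /eqP CE] /andP[CS dS]] /andP[/andP[vC' /eqP CE'] /andP[CS' dS']].
by rewrite -(component_cylinder vC CE CS dS) (component_cylinder vC' CE' CS' dS').
Qed.
End Percolation.

(** * Shattering a random block into components *)

Section Shattering.
Variables (R : realType) (V : finType) (G : sgraph V) (q k : nat).
Local Notation conf := {ffun V -> 'I_q}.
Variable mu : conf -> R.
Hypothesis mu_ge0 : forall x, 0 <= mu x.
Hypothesis mu_markov : forall A B : {set V}, [disjoint A & B] -> nonadjacent G A B ->
  four_point mu A B.
Variable col : V -> 'I_k.
Hypothesis col_proper : forall u v, G u v -> col u != col v.
Variable f : conf -> R.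
Hypothesis f_ge0 : forall x, 0 <= f x.
Implicit Types (S T A B C : {set V}) (u v w : V).
Local Notation rk := enum_rank.

Let rf_ge0 S x : 0 <= resample mu S f x. Proof. exact: resample_ge0. Qed.

(** The sites over which the entropy term at v stays averaged.  Only isolated
    sites are kept: they are exactly what survives when the component of v is
    shrunk to v, and they form an independent set in each class. *)
Definition later S v :=
  [set w in isolated G S | (col w == col v) && (rk v < rk w)%N].

Definition site_ent_later S v := block_ent mu [set v] (resample mu (later S v) f).

Lemma site_ent_later_ge0 S v : 0 <= site_ent_later S v.
Proof. by apply: block_ent_ge0 => // x; exact: resample_ge0. Qed.

Lemma minimal_rank S v : v \in S ->
  exists2 u, u \in S & forall w, w \in S -> (rk u <= rk w)%N.
Proof.
by move=> vS; case: (arg_minnP (fun w => nat_of_ord (rk w)) vS) => u uS h; exists u.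
Qed.

(** An isolated site in the component of u is u itself, which has minimal rank. *)
Lemma later_notin_component S u v w : u \in S ->
  (forall t, t \in S -> (rk u <= rk t)%N) -> v \in S ->
  w \in later S v -> w \notin component G S u.
Proof.
move=> uS umin vS; rewrite inE => /and3P[wi _ vw]; apply/negP => wu.
have := component_isolated wi; rewrite (component_eq wu) => e.
have := mem_component G S u; rewrite e inE => /eqP uw.
by move: (umin v vS); rewrite uw leqNgt vw.
Qed.

Lemma later_notin_own_component S v w : w \in later S v -> w \notin component G S v.
Proof.
rewrite inE => /and3P[wi _ vw]; apply/negP => wu.
have := component_isolated wi; rewrite (component_eq wu) => e.
by have := mem_component G S v; rewrite e inE => /eqP vE; rewrite vE ltnn in vw.
Qed.

Lemma later_setD_component S u v : u \in S ->
  (forall t, t \in S -> (rk u <= rk t)%N) -> v \in S :\: component G S u ->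
  later (S :\: component G S u) v = later S v.
Proof.
move=> uS umin vT; have vS : v \in S by move: vT; rewrite inE => /andP[].
set C := component G S u; set T := S :\: C.
have nCT : nonadjacent G C T by exact: component_nonadjacent.
have SE : S = C :|: T.
  by rewrite -{1}(setID S C) (setIidPr _) // component_sub.
apply/setP => w; apply/idP/idP => wl.
  have wT : w \in T by move: wl; rewrite !inE => /andP[/andP[]].
  by move: wl; rewrite ![w \in later _ _]inE SE isolatedU.
have wC := later_notin_component uS umin vS wl.
have wT : w \in T.
  by rewrite inE wC; move: wl; rewrite !inE => /andP[/andP[]].
by move: wl; rewrite ![w \in later _ _]inE {1}SE isolatedU.
Qed.

Lemma nonadjacent_site v A : v \notin A -> (forall w, w \in A -> ~~ G w v) ->
  [disjoint A & [set v]] /\ nonadjacent G A [set v].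
Proof.
move=> vA nv; split; first by rewrite disjoint_sym disjoints1 ?(negbTE vA).
by move=> u w uA; rewrite inE => /eqP ->; exact: nv.
Qed.

(** Averaging over fewer sites leaves more entropy at v. *)
Lemma site_ent_anti S A T v : A \subset T -> v \notin T ->
  (forall w, w \in T -> ~~ G w v) ->
  block_ent mu [set v] (resample mu T f) <=
  block_ent mu [set v] (resample mu A f).
Proof.
move=> AT vT nv; have [dT nT] := nonadjacent_site vT nv.
rewrite (@eq_block_ent _ _ _ mu mu_ge0 _ _ (resample mu T (resample mu A f))).
  by apply: (block_ent_resample_le mu_ge0) => //; exact: mu_markov.
by move=> x _; rewrite resample_resample.
Qed.

Variable K : nat -> R.
Hypothesis K_ge0 : forall m, 0 <= K m.
Hypothesis tensor : forall C (g : conf -> R), (forall x, 0 <= g x) ->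
  block_ent mu C g <= K #|C| * \sum_(v in C) block_ent mu [set v] g.

(** Peel off the component C of the site of least rank.  The chain rule leaves
    the entropy of C for f averaged over the rest of S, to which the
    tensorization applies; the rest contains every isolated site that is later
    than a site of C, so part of the averaging can be dropped.  The choice of the
    least rank also keeps the terms of the other sites unchanged. *)
Lemma block_ent_le_components S : block_ent mu S f <=
  \sum_(v in S) K #|component G S v| * site_ent_later S v.
Proof.
have [n] := ubnP #|S|; elim: n S => // n IH S; rewrite ltnS => Sn.
have [->|/set0Pn[v0 v0S]] := eqVneq S set0.
  by rewrite block_ent_set0 // big_set0.
have [u uS umin] := minimal_rank v0S.
set C := component G S u; set T := S :\: C.
have CS : C \subset S by exact: component_sub.
have nCT : nonadjacent G C T by exact: component_nonadjacent.
have nTC := nonadjacent_sym nCT.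
have dTC : [disjoint T & C] by rewrite disjoint_sym disjoints_subset setCD subsetUr.
have SE : S = T :|: C.
  by rewrite setUC -{1}(setID S C) (setIidPr _).
have Tn : (#|T| < n)%N.
  apply: leq_trans Sn; rewrite (cardsD1 u S) uS ltnS; apply: subset_leq_card.
  apply/subsetP => w; rewrite !inE => /andP[wC ->]; rewrite andbT.
  by apply: contraNneq wC => ->; exact: connect0.
rewrite {1}SE (block_ent_four_point mu_ge0 _ dTC (mu_markov dTC nTC)).
rewrite (bigID (mem C)) /= addrC; apply: lerD; last first.
  rewrite (eq_bigl (mem C)); last first.
    by move=> v /=; rewrite andb_idl // => /(subsetP CS).
  apply: le_trans (tensor _ (rf_ge0 T)) _; rewrite mulr_sumr.
  apply: ler_sum => v vC; rewrite (component_eq vC); apply: ler_wpM2l => //.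
  apply: site_ent_anti => //.
  - apply/subsetP => w wl; rewrite inE.
    rewrite (later_notin_component uS umin (subsetP CS v vC) wl) /=.
    by move: wl; rewrite !inE => /andP[/andP[]].
  - by rewrite inE vC.
  - by move=> w wT; exact: nTC.
rewrite (eq_bigl (mem T)); last by move=> v; rewrite /= !inE andbC.
apply: le_trans (IH T Tn) _; apply: ler_sum => v vT.
rewrite /site_ent_later later_setD_component //.
suff -> : component G T v = component G S v by [].
apply/esym/component_restrict => //; first exact: subsetDl.
suff -> : S :\: T = C by [].
by rewrite setDDr setDv set0U (setIidPr _).
Qed.

(** The chain rule, resampling the sites of an independent set in decreasing
    rank. *)
Lemma site_ent_chain (I : {set V}) : (forall u v, u \in I -> v \in I -> ~~ G u v) ->
  \sum_(v in I) block_ent mu [set v]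
     (resample mu [set w in I | (rk v < rk w)%N] f) = block_ent mu I f.
Proof.
have [n] := ubnP #|I|; elim: n I => // n IH I; rewrite ltnS => In nI.
have [->|/set0Pn[v0 v0I]] := eqVneq I set0.
  by rewrite block_ent_set0 // big_set0.
have [u uI umin] := minimal_rank v0I.
have [dI nIu] : [disjoint I :\ u & [set u]] /\ nonadjacent G (I :\ u) [set u].
  apply: nonadjacent_site; first by rewrite !inE eqxx.
  by move=> w; rewrite inE => /andP[_ wI]; exact: nI.
have uN w : w \in I -> w != u -> (rk u < rk w)%N.
  move=> wI wu; rewrite ltn_neqAle umin // andbT.
  by apply: contra wu => /eqP/ord_inj/enum_rank_inj ->.
have -> : block_ent mu I f = block_ent mu [set u] (resample mu (I :\ u) f)
    + block_ent mu (I :\ u) f.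
  rewrite addrC -(block_ent_four_point mu_ge0 _ dI (mu_markov dI nIu)).
  by rewrite setUC setD1K.
rewrite (bigD1 u) //=; congr (_ + _); last first.
  rewrite -(IH (I :\ u)); first last.
  - by move=> v w; rewrite !inE => /andP[_ vI] /andP[_ wI]; exact: nI.
  - by rewrite (leq_trans _ In) // [leqRHS](cardsD1 u I) uI.
  apply: eq_big => [v|v /andP[vI vu]]; first by rewrite !inE andbC.
  congr (block_ent _ _ (resample _ _ _)); apply/setP => w; rewrite !inE.
  case: eqP => // -> /=; rewrite uI /=.
  by apply/negbTE; rewrite -leqNgt; exact: umin.
congr (block_ent _ _ (resample _ _ _)); apply/setP => w; rewrite !inE.
case: eqVneq => [->|wu] /=; first by rewrite ltnn andbF.
by case: (boolP (w \in I)) => //= wI; exact: uN.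
Qed.

Definition color_class i := [set v | col v == i].

Lemma sum_isolated_site_ent_le S : \sum_(v in isolated G S) site_ent_later S v <=
  \sum_i block_ent mu (color_class i) f.
Proof.
rewrite (partition_big col xpredT) //=; apply: ler_sum => i _.
pose I := [set v in isolated G S | col v == i].
have nI u v : u \in I -> v \in I -> ~~ G u v.
  rewrite !inE => /andP[_ /eqP ui] /andP[_ /eqP vi].
  by apply: contraTN isT => /col_proper; rewrite ui vi eqxx.
apply: (@le_trans _ _ (block_ent mu I f)); last first.
  apply: block_ent_sub => //; apply/subsetP => v; by rewrite !inE => /andP[].
rewrite -(site_ent_chain nI) le_eqVlt; apply/orP; left; apply/eqP.
apply: eq_big => [v|v /andP[vi /eqP vc]]; first by rewrite !inE.
congr (block_ent _ _ (resample _ _ _)); apply/setP => w.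
by rewrite !inE vc andbA.
Qed.

Definition isolate S v := v |: (S :\: component G S v).

Lemma isolate_isolated S v : v \in S -> v \in isolated G (isolate S v).
Proof.
move=> vS; rewrite inE setU11; apply/forall_inP => w; rewrite inE in_set1.
move=> /orP[/eqP ->|wT]; first by rewrite (adj_irrefl G).
by apply: (component_nonadjacent vS) wT; exact: mem_component.
Qed.

Lemma later_isolate S v : v \in S -> later (isolate S v) v = later S v.
Proof.
move=> vS; set C := component G S v; set T := S :\: C.
have nCT : nonadjacent G C T by exact: component_nonadjacent.
have nvT : nonadjacent G [set v] T.
  by apply: nonadjacentS nCT => //; rewrite sub1set mem_component.
have SE : S = C :|: T.
  by rewrite -{1}(setID S C) (setIidPr _) // component_sub.
apply/setP => w; apply/idP/idP => wl.
  have wv : w != v.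
    by apply: contraTneq wl => ->; rewrite inE ltnn !andbF.
  have wT : w \in T.
    by move: wl; rewrite !inE (negbTE wv) /= => /andP[/andP[]].
  move: wl; rewrite ![w \in later _ _]inE SE.
  by rewrite isolatedU // -SE isolatedU.
have wC := later_notin_own_component wl.
have wT : w \in T.
  by rewrite inE wC; move: wl; rewrite !inE => /andP[/andP[]].
move: wl; rewrite ![w \in later _ _]inE [in isolated G S]SE.
by rewrite isolatedU // isolatedU.
Qed.

Lemma bernoulli_isolate (p : R) S v : v \in S -> p < 1 ->
  bernoulli p S =
  (p / (1 - p)) ^+ #|component G S v|.-1 * bernoulli p (isolate S v).
Proof.
move=> vS p1; set C := component G S v.
have CS : C \subset S by exact: component_sub.
have vC : v \in C by exact: mem_component.
have cS : #|S| = (#|C|.-1 + #|isolate S v|)%N.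
  rewrite cardsU1 inE vC /= addnCA -[in LHS](cardsID C S) (setIidPr CS).
  by rewrite -addnCA addnA addn1 prednK // (cardD1 v) vC.
have cSc : (#|~: isolate S v| = #|C|.-1 + #|~: S|)%N.
  apply/eqP; rewrite -(eqn_add2l #|isolate S v|) cardsC addnA [(_ + #|C|.-1)%N]addnC.
  by rewrite -cS cardsC.
have q0 : 1 - p != 0 by rewrite subr_eq0 gt_eqF.
rewrite /bernoulli cS cSc !exprD expr_div_n.
set a := p ^+ _; set c := (1 - p) ^+ _; set d := (1 - p) ^+ _.
have d0 : d != 0 by rewrite expf_neq0.
by field.
Qed.

(** Group the blocks S containing v by the component C of v, and send S to the
    block where C is shrunk to v.  For fixed C this map is injective, it turns
    v into an isolated site, preserves the entropy term at v, and changes the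
    weight by a factor depending on |C| only. *)
Lemma average_components_le (p M : R) : 0 <= p < 1 ->
  (forall v, \sum_(C : {set V} | (v \in C) && (component G C v == C))
     (p / (1 - p)) ^+ #|C|.-1 * K #|C| <= M) ->
  \sum_S bernoulli p S * block_ent mu S f <=
  M * \sum_i block_ent mu (color_class i) f.
Proof.
move=> /andP[p0 p1] KM.
have p01 : 0 <= p <= 1 by rewrite p0 ltW.
have q0 : 0 <= p / (1 - p) by rewrite divr_ge0 // subr_ge0 ltW.
have M0 v : 0 <= M.
  apply: le_trans (KM v); apply: sumr_ge0 => C _.
  by rewrite mulr_ge0 // exprn_ge0.
pose Q v := \sum_(S | v \in isolated G S) bernoulli p S * site_ent_later S v.
apply: (@le_trans _ _ (\sum_v M * Q v)).
  apply: (@le_trans _ _ (\sum_v \sum_(S : {set V} | v \in S)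
     bernoulli p S * (K #|component G S v| * site_ent_later S v))).
    rewrite (exchange_big_dep xpredT) //=; apply: ler_sum => S _.
    rewrite -mulr_sumr; apply: ler_wpM2l; first exact: bernoulli_ge0.
    exact: block_ent_le_components.
  apply: ler_sum => v _.
  have Q0 : 0 <= Q v.
    apply: sumr_ge0 => S _; rewrite mulr_ge0 ?bernoulli_ge0 //.
    exact: site_ent_later_ge0.
  apply: le_trans (ler_wpM2r Q0 (KM v)); rewrite mulr_suml.
  rewrite (partition_big (fun S => component G S v)
    (fun C : {set V} => (v \in C) && (component G C v == C))) /=; last first.
    move=> S vS; rewrite mem_component /= -(component_restrict (S := S)) //.
    - exact: component_sub.
    - exact: component_nonadjacent.
    - exact: mem_component.
  apply: ler_sum => C _; pose A := [set S : {set V} | (v \in S) && (component G S v == C)].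
  have inj : {in A &, injective (isolate^~ v)}.
    move=> S S'; rewrite !inE => /andP[vS /eqP SC] /andP[vS' /eqP SC'] e.
    have rec T : v \in T -> component G T v = C -> T = isolate T v :|: C.
      move=> vT TC; rewrite /isolate TC.
      have CT : C \subset T by rewrite -TC component_sub.
      have vC : v \in C by rewrite -TC mem_component.
      apply/setP => w; rewrite !inE; case: (boolP (w \in C)) => wC /=.
        by rewrite orbT (subsetP CT).
      by rewrite orbF; case: eqP => // wv; rewrite wv vC in wC.
    by rewrite (rec S) // (rec S') // e.
  rewrite -mulrA mulr_sumr.
  rewrite (eq_bigr (fun S => (p / (1 - p)) ^+ #|C|.-1 * (K #|C| *
     (bernoulli p (isolate S v) * site_ent_later (isolate S v) v)))); last first.
    move=> S /andP[vS /eqP SC]; rewrite (bernoulli_isolate vS p1) SC.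
    by rewrite /site_ent_later later_isolate //; ring.
  rewrite -!mulr_sumr; apply: ler_wpM2l; first exact: exprn_ge0.
  apply: ler_wpM2l => //.
  rewrite (eq_bigl (mem A)); last by move=> S; rewrite /= inE.
  rewrite -(big_imset (fun S => bernoulli p S * site_ent_later S v) inj) /=.
  rewrite big_mkcond [leRHS]big_mkcond; apply: ler_sum => S _.
  case: ifP => [/imsetP[S' + ->]|_].
    by rewrite inE => /andP[vS' _]; rewrite isolate_isolated.
  case: ifP => // _; rewrite mulr_ge0 ?bernoulli_ge0 //.
  exact: site_ent_later_ge0.
rewrite -mulr_sumr.
have [v _|V0] := pickP (mem setT : pred V); last first.
  rewrite big1 ?mulr0; last by move=> v; have := V0 v; rewrite !inE.
  rewrite big1 ?mulr0 // => i _.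
  suff -> : color_class i = set0 by rewrite block_ent_set0.
  by apply/setP => v; have := V0 v; rewrite !inE.
apply: ler_wpM2l; first exact: M0 v.
rewrite /Q (exchange_big_dep xpredT) //=.
rewrite -[leRHS]mul1r -(sum_bernoulli V p) mulr_suml.
apply: ler_sum => S _; rewrite -mulr_sumr; apply: ler_wpM2l.
  exact: bernoulli_ge0.
exact: sum_isolated_site_ent_le.
Qed.
End Shattering.

(** * Gibbs distributions are Markov *)

Section GibbsMarkov.
Variables (R : realType) (V : finType) (G : sgraph V) (q : nat).
Variables (S : spin_system R q) (bc : boundary_condition G q).
Local Notation conf := {ffun V -> 'I_q}.
Implicit Types (A B : {set V}) (x y : conf).

Lemma expeR_lty_fin_num (k : \bar R) : (k < +oo)%E -> expeR k \is a fin_num.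
Proof. by case: k => [r| |] //= _; rewrite ?expR0. Qed.

Lemma fine_expeR_sum (I : finType) (P : pred I) (F : I -> \bar R) :
  (forall i, F i < +oo)%E ->
  (\sum_(i | P i) F i < +oo)%E /\
  fine (expeR (\sum_(i | P i) F i)%E) = \prod_(i | P i) fine (expeR (F i)).
Proof.
move=> Fy; elim/big_rec2: _ => [|i s y _ [sy <-]].
  by rewrite expeR0 ltry.
by split; [exact: lte_add_pinfty | rewrite expeRD fineM ?expeR_lty_fin_num].
Qed.

(** Interactions may be -oo, so the exponential is taken of the extended sums
    first; they never reach +oo, so their exponentials are finite and
    multiply. *)
Lemma weight_factors x : weight S bc x =
  (\prod_(p : V * V | G p.1 p.2 && (enum_rank p.1 < enum_rank p.2)%N)
     fine (expeR (interaction S (x p.1) (x p.2))))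
  * (\prod_(p : V * {w | w \in bc_dom bc} | bc_graph bc (bc_emb bc p.1) (val p.2))
     fine (expeR (interaction S (x p.1) (bc_spin p.2))))
  * (\prod_v expR (self_energy S (x v))).
Proof.
have [Ay <-] := @fine_expeR_sum _
  (fun p : V * V => G p.1 p.2 && (enum_rank p.1 < enum_rank p.2)%N)
  (fun p => interaction S (x p.1) (x p.2)) (fun p => interaction_lty _ _ _).
have [By <-] := @fine_expeR_sum _
  (fun p : V * {w | w \in bc_dom bc} => bc_graph bc (bc_emb bc p.1) (val p.2))
  (fun p => interaction S (x p.1) (bc_spin p.2)) (fun p => interaction_lty _ _ _).
rewrite -expR_sum /weight /hamiltonian.
move: Ay By; set A := (\sum_(p | _) _)%E; set B := (\sum_(p | _) _)%E.
set c := \sum_v _; move: A B c => [a| |] [b'| |] c //= _ _; rewrite ?mul0r ?mulr0 ?mul0r //.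
by rewrite -!expRD; congr expR; ring.
Qed.

Lemma weight_ge0 x : 0 <= weight S bc x.
Proof. by rewrite fine_ge0 // expeR_ge0. Qed.

Lemma four_point_prod A B (I : finType) (P : pred I) (F : I -> conf -> R) :
  (forall i, P i -> four_point (F i) A B) ->
  four_point (fun x => \prod_(i | P i) F i x) A B.
Proof.
move=> FP x y; rewrite -!big_split /=; apply: eq_bigr => i Pi; exact: FP.
Qed.

Lemma four_pointM A B (W W' : conf -> R) : four_point W A B -> four_point W' A B ->
  four_point (fun x => W x * W' x) A B.
Proof. by move=> h h' x y; rewrite mulrACA h h' mulrACA. Qed.

(** A factor that does not see the spins of A takes the same value at x as at its
    splice on A, and the same value at the splice on B as at the splice on
    both. *)
Lemma four_point_local A B (W : conf -> R) (D : {set V}) :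
  [disjoint D & A] \/ [disjoint D & B] ->
  (forall x y, (forall v, v \in D -> x v = y v) -> W x = W y) ->
  four_point W A B.
Proof.
move=> dD WD x y; case: dD => dD.
  rewrite [W x](WD _ (splice A x y)); last first.
    by move=> v vD; rewrite ffunE (disjointFr dD vD).
  congr (_ * _); apply: WD => v vD.
  by rewrite !ffunE inE (disjointFr dD vD).
rewrite mulrC [W x](WD _ (splice B x y)); last first.
  by move=> v vD; rewrite ffunE (disjointFr dD vD).
congr (_ * _); apply: WD => v vD.
by rewrite !ffunE inE (disjointFr dD vD) orbF.
Qed.

Lemma disjoint_or A B v : [disjoint A & B] ->
  [disjoint [set v] & A] \/ [disjoint [set v] & B].
Proof.
move=> dAB; rewrite !disjoints1; case: (boolP (v \in A)) => vA; last by left.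
by right; rewrite (disjointFr dAB vA).
Qed.

(** No edge meets both A and B, and boundary terms and self-energies involve one
    site each; so every factor of the weight is local on one side. *)
Lemma gibbs_four_point A B : [disjoint A & B] -> nonadjacent G A B ->
  four_point (gibbs S bc) A B.
Proof.
move=> dAB nAB x y; rewrite /gibbs mulrACA [RHS]mulrACA; congr (_ * _).
suff : four_point (weight S bc) A B by apply.
move=> {}x {}y; rewrite !weight_factors.
move: x y; apply: four_pointM; first apply: four_pointM.
- apply: four_point_prod => -[u v] /= /andP[uv _].
  apply: (four_point_local (D := [set u; v])); last first.
    by move=> x y xy; rewrite !xy ?inE ?eqxx ?orbT.
  rewrite !disjoints_subset !subUset !sub1set !inE.
  case: (boolP (u \in B)) => uB /=.
    left; rewrite (disjointFl dAB uB) /=.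
    by apply/negP => vA; have := nAB v u vA uB; rewrite (adj_sym G) uv.
  case: (boolP (v \in B)) => vB /=; last by right.
  left; rewrite (disjointFl dAB vB) andbT.
  by apply/negP => uA; have := nAB u v uA vB; rewrite uv.
- apply: four_point_prod => -[u w] /= _.
  apply: (four_point_local (D := [set u])); first exact: disjoint_or.
  by move=> x y xy; rewrite xy ?inE.
- apply: four_point_prod => u _.
  apply: (four_point_local (D := [set u])); first exact: disjoint_or.
  by move=> x y xy; rewrite xy ?inE.
Qed.

Hypothesis Z_gt0 : 0 < partition_function S bc.

Lemma gibbs_ge0 x : 0 <= gibbs S bc x.
Proof. by rewrite divr_ge0 ?weight_ge0 // ltW. Qed.

Lemma sum_gibbs : \sum_x gibbs S bc x = 1.
Proof. by rewrite -mulr_suml divff // gt_eqF. Qed.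
End GibbsMarkov.

(** * Pinnings as classes of configurations *)

Section Dictionary.
Variables (R : realType) (V : finType) (q : nat).
Local Notation conf := {ffun V -> 'I_q}.
Variable mu : conf -> R.
Hypothesis mu_ge0 : forall x, 0 <= mu x.
Hypothesis mu_sum1 : \sum_x mu x = 1.
Implicit Types (S T B C L : {set V}) (x y : conf) (u v : V) (f : conf -> R).

Lemma Ent_block_ent f : Ent mu f = block_ent mu setT f.
Proof.
have rT x : resample mu setT f x = Ex mu f.
  rewrite /resample /mass.
  under eq_bigl do rewrite agree_offT.
  by under [X in _ / X]eq_bigl do rewrite agree_offT; rewrite mu_sum1 divr1.
rewrite /Ent /block_ent; congr (_ - _).
under [RHS]eq_bigr do rewrite rT.
by rewrite -mulr_suml mu_sum1 mul1r.
Qed.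

Lemma restr_eqP L x y :
  reflect (forall v, v \in L -> x v = y v) (restr L x == restr L y).
Proof.
apply: (iffP eqP) => [/ffunP h v vL|h].
  by have := h (exist _ v vL); rewrite !ffunE.
by apply/ffunP => -[v vL]; rewrite !ffunE /= h.
Qed.

(** The pinning events are the classes of [agree_off]. *)
Lemma agree_restr S x : agree (restr (~: S) x) = [set y | agree_off S x y].
Proof.
apply/setP => y; rewrite !inE; apply/restr_eqP/agree_offP => h v vS.
  by rewrite h ?inE.
by rewrite h // -in_setC.
Qed.

Lemma Pr_agree_restr S x : Pr mu (agree (restr (~: S) x)) = mass mu S x.
Proof. by rewrite agree_restr; apply: eq_bigl => y; rewrite inE. Qed.

(** The value of [glue] is defined by a match on a membership proof; this lemma
    and the next one remove it, and the sequel only uses them. *)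
Lemma glue_in B (tau : pconf q (~: B)) (xi : pconf q B) v (vB : v \in B) :
  glue tau xi v = xi (exist _ v vB).
Proof.
rewrite ffunE; case: {-}_ / boolP => [vB'|vB']; last first.
  by exfalso; move/negP: (vB'); apply.
by congr (xi (exist _ v _)); exact: bool_irrelevance.
Qed.

Lemma glue_out B (tau : pconf q (~: B)) (xi : pconf q B) v (vB : v \in ~: B) :
  glue tau xi v = tau (exist _ v vB).
Proof.
rewrite ffunE; case: {-}_ / boolP => [vB'|vB'].
  by exfalso; move: (vB); rewrite inE => /negP; apply.
by congr (tau (exist _ v _)); exact: bool_irrelevance.
Qed.
Lemma restr_glue_in B (tau : pconf q (~: B)) (xi : pconf q B) :
  restr B (glue tau xi) = xi.
Proof. by apply/ffunP => -[v vB]; rewrite ffunE glue_in. Qed.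

Lemma restr_glue_out B (tau : pconf q (~: B)) (xi : pconf q B) :
  restr (~: B) (glue tau xi) = tau.
Proof. by apply/ffunP => -[v vB]; rewrite ffunE glue_out. Qed.

Lemma glue_restr B x y : agree_off B x y ->
  glue (restr (~: B) x) (restr B y) = y.
Proof.
move=> /agree_offP xy; apply/ffunP => v; case: (boolP (v \in B)) => vB.
  by rewrite (glue_in _ _ vB) ffunE.
have vB' : v \in ~: B by rewrite inE.
by rewrite (glue_out _ _ vB') ffunE xy.
Qed.

Lemma sum_glue B (F : conf -> R) :
  \sum_x F x = \sum_(tau : pconf q (~: B)) \sum_(xi : pconf q B) F (glue tau xi).
Proof.
rewrite pair_big /=; apply: (reindex (fun p : pconf q (~: B) * pconf q B =>
  glue p.1 p.2)).
exists (fun x => (restr (~: B) x, restr B x)) => [[tau xi] _|x _] /=.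
  by rewrite restr_glue_in restr_glue_out.
by apply: glue_restr; exact: agree_off_refl.
Qed.

Lemma sum_agree_glue B (F : conf -> R) tau (xi : pconf q B) :
  \sum_(y | agree_off B (glue tau xi) y) F y = \sum_zeta F (glue tau zeta).
Proof.
rewrite (reindex (glue tau)) /=; last first.
  exists (restr B) => [zeta _|y]; first exact: restr_glue_in.
  by rewrite inE => /glue_restr; rewrite restr_glue_out.
apply: eq_bigl => zeta; apply/agree_offP => v vB.
have vB' : v \in ~: B by rewrite inE.
by rewrite !(glue_out _ _ vB').
Qed.

Lemma agree_glue B (tau : pconf q (~: B)) (xi : pconf q B) :
  agree xi :&: agree tau = [set glue tau xi].
Proof.
apply/setP => y; rewrite !inE; apply/andP/eqP => [[/eqP <- /eqP <-]|->].
  by rewrite glue_restr // agree_off_refl.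
by rewrite restr_glue_in restr_glue_out.
Qed.

Lemma marginal_glue B (tau : pconf q (~: B)) (xi : pconf q B) :
  marginal mu tau = mass mu B (glue tau xi).
Proof. by rewrite -Pr_agree_restr restr_glue_out. Qed.

Lemma marginalE B (tau : pconf q (~: B)) :
  marginal mu tau = \sum_(xi : pconf q B) mu (glue tau xi).
Proof.
rewrite /marginal /Pr (reindex (glue tau)) /=; last first.
  exists (restr B) => [zeta _|y]; first exact: restr_glue_in.
  by rewrite inE => /eqP <-; rewrite glue_restr // agree_off_refl.
by apply: eq_bigl => xi; rewrite inE restr_glue_out eqxx.
Qed.

Lemma expected_Ent_block_ent B f : expected_Ent mu B f = block_ent mu B f.
Proof.
rewrite /block_ent /Ex !(sum_glue B) -sumrB; apply: eq_bigr => tau _.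
have condE (k : conf -> R) :
    \sum_xi cond_marginal mu tau xi * k (glue tau xi) =
    (\sum_xi mu (glue tau xi) * k (glue tau xi)) / marginal mu tau.
  rewrite mulr_suml; apply: eq_bigr => xi _.
  by rewrite /cond_marginal /cPr agree_glue /Pr big_set1 mulrAC.
rewrite /Ent /Ex (condE (fun y => f y * ln (f y))) (condE f).
set m := marginal mu tau.
have [m0|m0] := eqVneq m 0.
  have mu0 xi : mu (glue tau xi) = 0.
    have := m0; rewrite /m marginalE => /eqP.
    by rewrite psumr_eq0 // => /allP/(_ xi (mem_index_enum _))/eqP.
  by rewrite m0 mul0r !big1 ?subrr // => xi _; rewrite mu0 mul0r.
rewrite mulrBr; congr (_ - _); first by field.
have resE xi : resample mu B f (glue tau xi) =
    (\sum_zeta mu (glue tau zeta) * f (glue tau zeta)) / m.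
  by rewrite /resample sum_agree_glue -marginal_glue.
under [RHS]eq_bigr do rewrite resE.
by rewrite -mulr_suml -marginalE.
Qed.

Lemma site_bounded_of_marginally_bounded b :
  marginally_bounded mu b -> site_bounded mu b.
Proof.
move=> mb S v x vS mx.
have mS := mass_gt0 mu_ge0 S mx; have mSv := mass_gt0 mu_ge0 (S :\ v) mx.
have cE : cPr mu (spin_at v (x v)) (agree (restr (~: S) x)) =
    mass mu (S :\ v) x / mass mu S x.
  rewrite /cPr Pr_agree_restr; congr (_ / _); apply: eq_bigl => y.
  rewrite agree_restr !inE; apply/andP/agree_offP => [[/eqP yv /agree_offP h] w|h].
    by rewrite !inE negb_and negbK => /orP[/eqP ->|/h].
  split; first by rewrite h // !inE eqxx.
  by apply/agree_offP => w wS; apply: h; rewrite !inE (negbTE wS) andbF.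
have := mb (~: S) (restr (~: S) x) _ v (x v).
rewrite cE ler_pdivlMr //; apply.
  by rewrite inE /marginal Pr_agree_restr.
by rewrite inE /= inE negbK vS cE divr_gt0.
Qed.

(** A pinned configuration on C is extended by the spins of x outside C; a path of
    single-site flips is carried over edge by edge. *)
Lemma flip_connected_of_totally_connected :
  totally_connected mu -> flip_connected mu.
Proof.
move=> tc C x y mx my xy; set L := ~: C.
have cC : ~: L = C by rewrite setCK.
pose ext (p : pconf q (~: L)) : conf :=
  [ffun v => if insub v is Some w then p w else x v].
have ext_restr z : agree_off C x z -> ext (restr (~: L) z) = z.
  move=> /agree_offP xz; apply/ffunP => v; rewrite ffunE.
  case: insubP => [w vL wv|]; first by rewrite ffunE wv.
  by rewrite cC => /xz.
have agreeE p : agree p :&: agree (restr L x) = [set ext p].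
  apply/setP => z; rewrite !inE; apply/andP/eqP => [[/eqP <- zx]|->].
    rewrite ext_restr //; apply/agree_offP => v vC.
    by rewrite (restr_eqP _ _ _ zx) // inE.
  split.
    apply/eqP/ffunP => -[v vL]; rewrite !ffunE /=.
    by case: insubP => [w _ wv|]; [congr (p _); exact: val_inj | rewrite vL].
  apply/restr_eqP => v vL; rewrite ffunE; case: insubP => // w + _.
  by rewrite inE vL.
have mL := mass_gt0 mu_ge0 C mx.
have condE p : (p \in Omega_cond mu (restr L x) (~: L)) = (0 < mu (ext p)).
  rewrite inE /cond_marginal /cPr agreeE /Pr big_set1 -/(Pr mu _).
  by rewrite Pr_agree_restr pmulr_lgt0 // invr_gt0.
have := tc L (restr L x) _ (restr (~: L) x) (restr (~: L) y).
rewrite !condE !ext_restr ?agree_off_refl // inE /marginal Pr_agree_restr.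
move=> /(_ mL mx my) /connectP[p pth e].
have -> : x = ext (restr (~: L) x) by rewrite ext_restr // agree_off_refl.
have -> : y = ext (restr (~: L) y) by rewrite ext_restr.
rewrite {}e; elim: p (restr (~: L) x) pth => [|b p IH] a //= /andP[ab /IH].
apply: connect_trans; apply: connect1.
move: ab; rewrite /flip_rel /flip /= !condE => /and3P[-> -> /cards1P[w wE]] /=.
apply/existsP; exists (val w); rewrite -cC (valP w) /=.
apply/agree_offP => v; rewrite inE => vw; rewrite !ffunE.
case: insubP => // t _ tv; apply/eqP/negPn/negP => tn.
have : t \in [set v | a v != b v] by rewrite inE.
by rewrite wE inE => /eqP tw; rewrite -tv tw eqxx in vw.
Qed.
End Dictionary.

(** * Spectral independence bounds covariances *)

(** The influence matrix is not symmetric, but scaling its rows by the marginal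
    probabilities gives the covariance matrix of the spin indicators, with zero
    diagonal blocks.  So Q, with entries covariance / sqrt (p_i p_j), is symmetric
    and similar to the influence matrix. *)
Section SpectralCovariance.
Variables (R : realType) (V : finType) (q : nat).
Local Notation conf := {ffun V -> 'I_q}.
Variable mu : conf -> R.
Hypothesis mu_ge0 : forall x, 0 <= mu x.
Variables (S : {set V}) (x : conf).
Hypothesis mx : 0 < mu x.
Local Notation tau := (restr (~: S) x).
Local Notation E k := (resample mu S k x).
Local Notation event us := (spin_at us.1 us.2).
Implicit Types (us vt : V * 'I_q).

Let prob us := cPr mu (event us) (agree tau).
Let joint us vt := cPr mu (event us :&: event vt) (agree tau).

Let mass_p : 0 < mass mu S x. Proof. exact: mass_gt0. Qed.

Let cPr_E A : cPr mu A (agree tau) = E (fun y => (y \in A)%:R).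
Proof.
rewrite /cPr Pr_agree_restr /resample; congr (_ / _).
rewrite /Pr agree_restr big_mkcond [RHS]big_mkcond; apply: eq_bigr => y _.
rewrite inE [y \in [set _ | _]]inE.
by case: (y \in A); case: (agree_off S x y); rewrite /= ?mulr1 ?mulr0.
Qed.

Let prob_ge0 us : 0 <= prob us.
Proof. by rewrite /prob cPr_E; apply: resample_ge0 => // y; rewrite ler0n. Qed.

Let joint_le us vt : 0 <= joint us vt <= prob us.
Proof.
rewrite /joint /prob !cPr_E; apply/andP; split.
  by apply: resample_ge0 => // y; exact: ler0n.
apply: resample_le => // y _ _; rewrite ler_nat in_setI.
by case: (y \in event us) => //=; case: (_ \in _).
Qed.

Let jointC us vt : joint us vt = joint vt us.
Proof. by rewrite /joint setIC. Qed.

Let feasibleE us : (us \in feasible mu tau) = (us.1 \in S) && (0 < prob us).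
Proof. by rewrite inE in_setC negbK. Qed.

(* Pairs of probability zero have no row in the influence matrix and contribute
   nothing to the sums. *)
Let sum_feasible (F : V * 'I_q -> R) : (forall us, prob us = 0 -> F us = 0) ->
  \sum_(us in feasible mu tau) F us = \sum_(u in S) \sum_a F (u, a).
Proof.
move=> F0; rewrite pair_big_dep /= big_mkcond [RHS]big_mkcond /=.
apply: eq_bigr => -[u a] _ /=; rewrite andbT feasibleE /=.
case: (u \in S) => //=; case: ifP => // /negbT; rewrite -leNgt => h.
by apply/esym/F0/le_anti; rewrite h prob_ge0.
Qed.

Variable phi : V -> 'I_q -> R.
Let phi' us := phi us.1 us.2.

Let phi_sum u (y : conf) : phi u (y u) = \sum_a phi u a * (y \in spin_at u a)%:R.
Proof.
rewrite (bigD1 (y u)) //= inE eqxx mulr1 big1 ?addr0 // => a.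
by rewrite inE eq_sym => /negbTE ->; rewrite mulr0.
Qed.

Let E_phi u : E (fun y => phi u (y u)) = \sum_a phi u a * prob (u, a).
Proof.
rewrite (@eq_resample _ _ _ mu mu_ge0 _ _ (fun y => \sum_a phi u a * (y \in spin_at u a)%:R)).
  rewrite resample_sum; apply: eq_bigr => a _.
  by rewrite resampleZ /prob cPr_E.
by move=> y _ _; exact: phi_sum.
Qed.

Let E_phi2 u : E (fun y => phi u (y u) ^+ 2) = \sum_a phi u a ^+ 2 * prob (u, a).
Proof.
rewrite (@eq_resample _ _ _ mu mu_ge0 _ _
  (fun y => \sum_a phi u a ^+ 2 * (y \in spin_at u a)%:R)).
  rewrite resample_sum; apply: eq_bigr => a _.
  by rewrite resampleZ /prob cPr_E.
move=> y _ _; rewrite (bigD1 (y u)) //= inE eqxx mulr1 big1 ?addr0 // => a.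
by rewrite inE eq_sym => /negbTE ->; rewrite mulr0.
Qed.

Let E_phi_phi u v : E (fun y => phi u (y u) * phi v (y v)) =
  \sum_a \sum_c phi u a * phi v c * joint (u, a) (v, c).
Proof.
rewrite (@eq_resample _ _ _ mu mu_ge0 _ _ (fun y => \sum_a \sum_c
   phi u a * phi v c * (y \in spin_at u a :&: spin_at v c)%:R)).
  rewrite resample_sum; apply: eq_bigr => a _.
  rewrite resample_sum; apply: eq_bigr => c _.
  by rewrite resampleZ /joint cPr_E.
move=> y _ _; rewrite !phi_sum mulr_suml; apply: eq_bigr => a _.
rewrite mulr_sumr; apply: eq_bigr => c _.
by rewrite mulrACA; congr (_ * _); rewrite in_setI -natrM mulnb.
Qed.

Let cov us vt := if us.1 == vt.1 then 0 else joint us vt - prob us * prob vt.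

Let covC us vt : cov us vt = cov vt us.
Proof. by rewrite /cov eq_sym jointC [prob us * _]mulrC. Qed.

Let Psi_cov i j : prob (enum_val i) * Psi mu tau i j = cov (enum_val i) (enum_val j).
Proof.
rewrite mxE; have := enum_valP i; move: (enum_val i) (enum_val j) => us vt.
rewrite feasibleE => /andP[_ p0]; rewrite /cov.
case: us p0 => u a p0; case: vt => v c /=; case: ifP => _; first exact: mulr0.
rewrite mulrBr; congr (_ - _); rewrite /prob /joint /cPr /=.
rewrite setIA [spin_at v c :&: _]setIC.
have : Pr mu (spin_at u a :&: agree tau) != 0.
  by apply: contraTneq p0 => e; rewrite /prob /cPr e mul0r ltxx.
by rewrite Pr_agree_restr => n0; field; rewrite n0 gt_eqF.
Qed.

Variable eta : R.
Hypothesis Psi_eigen : forall a, eigenvalue (Psi mu tau) a -> a <= eta.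
Hypothesis phi_centered : forall u, u \in S -> E (fun y => phi u (y u)) = 0.

Let rt i : R := Num.sqrt (prob (enum_val (A := mem (feasible mu tau)) i)).

Let rt_gt0 i : 0 < rt i.
Proof.
by rewrite sqrtr_gt0; have := enum_valP i; rewrite feasibleE => /andP[].
Qed.

Let rt2 i : rt i * rt i = prob (enum_val i).
Proof. by rewrite -expr2 sqr_sqrtr. Qed.

Let Q : 'M[R]_#|feasible mu tau| :=
  \matrix_(i, j) (cov (enum_val i) (enum_val j) / (rt i * rt j)).

Let Q_sym : Q^T = Q.
Proof. by apply/matrixP => i j; rewrite !mxE covC [rt j * _]mulrC. Qed.

Let Q_eigen a : eigenvalue Q a -> a <= eta.
Proof.
move=> /eigenvalueP[v vQ v0]; apply: Psi_eigen; apply/eigenvalueP.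
exists (\row_i (v 0 i * rt i)).
  apply/rowP => j; have /rowP/(_ j) := vQ; rewrite [LHS]mxE [RHS]mxE => vQj.
  rewrite [LHS]mxE [RHS]mxE [X in _ = _ * X]mxE mulrA -vQj mulr_suml.
  apply: eq_bigr => i _; rewrite [X in X * _ = _]mxE [Q i j]mxE -Psi_cov -rt2.
  by move: (Psi _ _ i j) => t; field; rewrite !gt_eqF.
apply: contraNneq v0 => /rowP w0; apply/eqP/rowP => i.
have := w0 i; rewrite !mxE => /eqP; rewrite mulf_eq0 [rt i == 0]gt_eqF // orbF.
by move/eqP.
Qed.

Lemma covariance_le_spectral :
  \sum_(u in S) \sum_(v in S :\ u) E (fun y => phi u (y u) * phi v (y v)) <=
  eta * \sum_(u in S) E (fun y => phi u (y u) ^+ 2).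
Proof.
pose w : 'rV[R]_#|feasible mu tau| := \row_i (rt i * phi' (enum_val i)).
have := quadratic_form_le_eigenvalue Q_sym Q_eigen w.
have -> : (w *m w^T) 0 0 = \sum_(u in S) E (fun y => phi u (y u) ^+ 2).
  rewrite mxE.
  transitivity (\sum_(us in feasible mu tau) phi' us ^+ 2 * prob us).
    rewrite [RHS]big_enum_val; apply: eq_bigr => i _; rewrite !mxE -rt2; ring.
  rewrite sum_feasible; last by move=> us ->; rewrite mulr0.
  by apply: eq_bigr => u uS; rewrite E_phi2.
suff -> : (w *m Q *m w^T) 0 0 = \sum_(u in S) \sum_(v in S :\ u)
    E (fun y => phi u (y u) * phi v (y v)) by [].
transitivity (\sum_(us in feasible mu tau) \sum_(vt in feasible mu tau)
    phi' us * phi' vt * cov us vt).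
  rewrite mxE [RHS]exchange_big [RHS]big_enum_val; apply: eq_bigr => j _.
  rewrite !mxE mulr_suml [RHS]big_enum_val; apply: eq_bigr => i _.
  by rewrite !mxE; field; rewrite !gt_eqF.
have cov0 us vt : prob us = 0 -> cov us vt = 0.
  move=> p0; rewrite /cov; case: ifP => // _; rewrite p0 mul0r subr0.
  by apply/le_anti; have := joint_le us vt; rewrite p0 andbC.
rewrite sum_feasible; last first.
  by move=> us p0; rewrite big1 // => vt _; rewrite cov0 ?mulr0.
apply: eq_bigr => u uS.
transitivity (\sum_a \sum_(v in S) \sum_c
    phi' (u, a) * phi' (v, c) * cov (u, a) (v, c)).
  apply: eq_bigr => a _.
  apply: (sum_feasible (F := fun vt => phi' (u, a) * phi' vt * cov (u, a) vt)).
  by move=> vt p0; rewrite covC cov0 ?mulr0.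
rewrite exchange_big /= [LHS](bigD1 u) //= big1 ?add0r; last first.
  by move=> a _; rewrite big1 // => c _; rewrite /cov eqxx mulr0.
apply: eq_big => [v|v /andP[vS vu]]; first by rewrite !inE andbC.
have z : (\sum_a phi u a * prob (u, a)) * (\sum_a phi v a * prob (v, a)) = 0.
  by rewrite -E_phi phi_centered // mul0r.
rewrite E_phi_phi -[RHS]subr0 -[X in _ = _ - X]z.
rewrite mulr_suml -sumrB; apply: eq_bigr => a _.
rewrite mulr_sumr -sumrB; apply: eq_bigr => c _.
by rewrite /cov /= eq_sym (negbTE vu) /phi' /=; ring.
Qed.
End SpectralCovariance.

Lemma covariance_bounded_of_spectrally_independent (R : realType) (V : finType)
    (q : nat) (mu : {ffun V -> 'I_q} -> R) (eta : R) :
  (forall x, 0 <= mu x) -> spectrally_independent mu eta ->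
  covariance_bounded mu eta.
Proof.
move=> mu0 si S x phi mx phi0.
have [->|S0] := eqVneq S set0; first by rewrite !big_set0 mulr0.
apply: (covariance_le_spectral mu0 mx) => // a; apply: si.
  by rewrite setCK.
by rewrite inE /marginal Pr_agree_restr mass_gt0.
Qed.

(** * Partite factorization *)

Section Factorization.
Variables (R : realType) (V : finType) (G : sgraph V) (q k : nat).
Local Notation conf := {ffun V -> 'I_q}.
Variable mu : conf -> R.
Hypothesis mu_ge0 : forall x, 0 <= mu x.
Hypothesis mu_markov : forall A B : {set V}, [disjoint A & B] ->
  nonadjacent G A B -> four_point mu A B.
Variables (eta b : R) (r Delta : nat).
Hypotheses (eta_gt0 : 0 < eta) (b_gt0 : 0 < b) (b_le1 : b <= 1).
Hypothesis r_ge : 2 * eta / b <= r%:R.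
Hypotheses (Delta_gt0 : (0 < Delta)%N) (Delta_ge : (max_degree G <= Delta)%N).
Hypotheses (mu_bounded : site_bounded mu b) (mu_connected : flip_connected mu).
Hypothesis mu_cov : covariance_bounded mu eta.
Variable col : V -> 'I_k.
Hypothesis col_proper : forall u v, G u v -> col u != col v.

Lemma bernoulli_ineq (p : R) m : 0 <= p <= 1 -> 1 - m%:R * p <= (1 - p) ^+ m.
Proof.
move=> /andP[p0 p1]; elim: m => [|m IH]; first by rewrite mul0r subr0 expr0.
have q0 : 0 <= 1 - p by rewrite subr_ge0.
rewrite exprS; apply: le_trans (ler_wpM2l q0 IH).
rewrite -natr1; have := mulr_ge0 (ler0n R m) (mulr_ge0 p0 p0); nra.
Qed.

(* The component of a site then costs b^-4 theta / (1 - theta) <= 1 / (4 Delta)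
   per site, because theta <= 1/2. *)
Let theta : R := (8 * b ^- 4 * Delta%:R)^-1.

Let d_gt0 : 0 < Delta%:R :> R. Proof. by rewrite ltr0n. Qed.
Let d_ge1 : 1 <= Delta%:R :> R. Proof. by rewrite ler1n. Qed.
Let a_ge1 : 1 <= b ^- 4.
Proof. by rewrite invf_ge1 ?exprn_gt0 // exprn_ile1 // ltW. Qed.
Let t_gt0 : 0 < theta.
Proof. by rewrite invr_gt0 !mulr_gt0 // invr_gt0 exprn_gt0. Qed.
Let t_half : theta <= 2^-1.
Proof.
rewrite lef_pV2 ?posrE // ?mulr_gt0 ?invr_gt0 ?exprn_gt0 //.
by have := mulr_ege1 a_ge1 d_ge1; rewrite -mulrA; lra.
Qed.

Let K m : R := 4 / b ^+ (4 * m).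

Let K_ge0 m : 0 <= K m.
Proof. by rewrite divr_ge0 // exprn_ge0 // ltW. Qed.

(** Percolation with p = 1 / (2 Delta): (1 - p)^Delta >= 1/2 gives
    p (1 - p)^Delta >= 1 / (4 Delta), so the weights are dominated by those of
    [sum_connected_sets].  The exponent |C| - 1 instead of |C| costs the final
    factor 1 / theta. *)
Lemma component_weights_le v :
  \sum_(C : {set V} | (v \in C) && (component G C v == C))
     (theta / (1 - theta)) ^+ #|C|.-1 * K #|C| <= 4 / theta.
Proof.
set s := theta / (1 - theta).
have t1 : 0 < 1 - theta by have := t_half; lra.
have s0 : 0 < s by rewrite divr_gt0.
pose p : R := (2 * Delta%:R)^-1.
have p0 : 0 < p by rewrite invr_gt0 mulr_gt0.
have pd : Delta%:R * p = 2^-1 by rewrite /p; field; rewrite gt_eqF.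
have p1 : p <= 1.
  have : p <= Delta%:R * p by rewrite ler_peMl // ltW.
  rewrite pd; lra.
have p01 : 0 <= p <= 1 by rewrite ltW.
have sp : s * b ^- 4 <= p * (1 - p) ^+ max_degree G.
  apply: (@le_trans _ _ (p * 2^-1)).
    have -> : p * 2^-1 = theta * 2 * b ^- 4.
      by rewrite /p /theta; field; rewrite !gt_eqF ?exprn_gt0.
    apply: ler_wpM2r; first by rewrite (le_trans _ a_ge1).
    apply: ler_wpM2l; first exact: ltW.
    by rewrite -[leRHS]invrK lef_pV2 ?posrE //; have := t_half; lra.
  apply: ler_wpM2l; first exact: ltW.
  apply: (@le_trans _ _ ((1 - p) ^+ Delta)); last first.
    by apply: ler_wiXn2l => //; lra.
  by have := bernoulli_ineq Delta p01; rewrite pd; lra.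
apply: (@le_trans _ _ (4 / s * \sum_(C : {set V} | (v \in C) && (component G C v == C))
    (p * (1 - p) ^+ max_degree G) ^+ #|C|)).
  rewrite mulr_sumr; apply: ler_sum => C /andP[vC _].
  have -> : s ^+ #|C|.-1 * K #|C| = 4 / s * (s * b ^- 4) ^+ #|C|.
    have cC : (0 < #|C|)%N by rewrite card_gt0; apply/set0Pn; exists v.
    rewrite /K -(prednK cC) /=; move: #|C|.-1 => j.
    rewrite exprM [(s * _) ^+ _]exprMn [(b ^- 4) ^+ _]exprVn [s ^+ j.+1]exprS.
    have : (b ^+ 4) ^+ j.+1 != 0 by rewrite !expf_neq0 // gt_eqF.
    move: ((b ^+ 4) ^+ j.+1) (s ^+ j) => z w z0.
    by field; rewrite z0 gt_eqF.
  apply: ler_wpM2l; first by rewrite divr_ge0 // ltW.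
  apply: lerXn2r sp; rewrite nnegrE.
    by apply: mulr_ge0; [exact: ltW | rewrite (le_trans _ a_ge1)].
  by apply: mulr_ge0; [exact: ltW | apply: exprn_ge0; rewrite subr_ge0].
apply: (@le_trans _ _ (4 / s)).
  by apply: ler_piMr; [rewrite divr_ge0 // ltW | exact: sum_connected_sets].
apply: ler_wpM2l => //; rewrite lef_pV2 ?posrE //.
by rewrite ler_pdivlMr //; apply: ler_piMr; [exact: ltW | rewrite lerBlDr lerDl ltW].
Qed.

(** The lower bound theta^(r+1) h(V) and the upper bound 4 / theta on the
    average over random blocks. *)
Lemma partite_factorization f : (forall x, 0 <= f x) ->
  block_ent mu setT f <=
  4 * (8 * b ^- 4 * Delta%:R) ^+ r.+2 * \sum_i block_ent mu (color_class col i) f.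
Proof.
move=> f0.
have t1 : theta < 1 by have := t_half; lra.
have t01 : 0 <= theta < 1 by rewrite ltW.
have t01' : 0 <= theta <= 1 by rewrite !ltW.
have h0 S : 0 <= block_ent mu S f by exact: block_ent_ge0.
have low := bernoulli_sum_ge h0 r_ge
  (fun S => block_ent_remove_site mu_ge0 eta_gt0 b_gt0 mu_bounded mu_cov f0 S) t01'.
have tens C g : (forall x, 0 <= g x) ->
  block_ent mu C g <= K #|C| * \sum_(v in C) block_ent mu [set v] g.
  by move=> g0; exact: crude_entropy_tensorization.
have up := average_components_le mu_ge0 mu_markov col_proper f0 K_ge0 tens t01
  component_weights_le.
have := le_trans low up.
rewrite -ler_pdivlMl ?exprn_gt0 // => /le_trans; apply.
rewrite mulrA le_eqVlt; apply/orP; left; apply/eqP; congr (_ * _).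
by rewrite -exprVn /theta !invrK mulrCA -exprSr.
Qed.
End Factorization.

Lemma ln4_ge1 (R : realType) : 1 <= ln (4 : R).
Proof.
have h : ln (2^-1 : R) <= - 2^-1.
  have := @le_ln1Dx R (- 2^-1).
  have -> : 1 + - 2^-1 = 2^-1 :> R by field.
  by apply; lra.
rewrite lnV ?posrE // lerNl opprK in h.
have -> : (4 : R) = 2 * 2 by ring.
by rewrite lnM ?posrE //; lra.
Qed.

Lemma max_degree_lt (V : finType) (G : sgraph V) :
  (0 < max_degree G)%N -> (max_degree G < #|V|)%N.
Proof.
move=> d0; have [v _|V0] := pickP (mem setT : pred V); last first.
  move: d0; rewrite /max_degree big1 // => v.
  by have := V0 v; rewrite !inE.
have V0 : (0 < #|V|)%N by apply/card_gt0P; exists v.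
rewrite -(prednK V0) ltnS; apply/bigmax_leqP => u _.
rewrite -ltnS (prednK V0) -cardsT; apply: proper_card; rewrite properT.
by apply/eqP => /setP/(_ u); rewrite !inE (adj_irrefl G).
Qed.

(** A function that is nonnegative on the support may be replaced by 0 elsewhere.
    The bound b <= 1, needed to compare constants, follows from marginal
    boundedness at any configuration of the support. *)
Lemma gibbs_KPF (R : realType) (V : finType) (G : sgraph V) (q : nat)
    (S : spin_system R q) (bc : boundary_condition G q) (eta b : R) (r k : nat)
    (D : R) :
  0 < eta -> 0 < b -> 2 * eta / b <= r%:R -> (0 < max_degree G)%N ->
  0 < partition_function S bc ->
  totally_connected (gibbs S bc) ->
  marginally_bounded (gibbs S bc) b ->
  spectrally_independent (gibbs S bc) eta ->
  (b <= 1 -> 4 * (8 * b ^- 4 * (max_degree G)%:R) ^+ r.+2 <= D) ->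
  KPF (gibbs S bc) G k D.
Proof.
move=> eta0 b0 rge d0 Z0 tc mb si leD U Udis Uind Ucov f f0.
set mu := gibbs S bc.
have mu0 : forall x, 0 <= mu x by exact: gibbs_ge0.
have mu1 : \sum_x mu x = 1 by exact: sum_gibbs.
have sb := site_bounded_of_marginally_bounded mu0 mb.
have [x mx] : exists x, 0 < mu x.
  apply/existsP; apply: contraT; rewrite negb_exists => /forallP h.
  have := oner_neq0 R; rewrite -mu1 big1 ?eqxx // => x _.
  by apply/le_anti; rewrite mu0 leNgt h.
have [v0 _] : exists v : V, true.
  by have /card_gt0P[v _] := leq_ltn_trans (leq0n _) (max_degree_lt d0); exists v.
have b1 : b <= 1 := site_bounded_le1 mu0 sb (in_setT v0) mx.
pose f' x := if 0 < mu x then f x else 0.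
have f'0 y : 0 <= f' y by rewrite /f'; case: ifP => // my; apply: f0; rewrite inE.
have ff' A : block_ent mu A f = block_ent mu A f'.
  by apply: eq_block_ent => // y my; rewrite /f' my.
have colP v : exists i, v \in U i.
  have : v \in \bigcup_(i < k) U i by rewrite Ucov inE.
  by move=> /bigcupP[i _ vi]; exists i.
have [col {}colP] := fin_all_exists colP.
have UE i : U i = color_class col i.
  apply/setP => v; rewrite inE; apply/idP/eqP => [vi|<- //].
  apply/eqP; apply: contraT => ne.
  by have := disjointFr (Udis _ _ ne) (colP v); rewrite vi.
have proper u v : G u v -> col u != col v.
  move=> uv; apply/negP => /eqP e.
  by have := Uind (col u) u v (colP u); rewrite e uv => /(_ (colP v)).
rewrite (Ent_block_ent mu1) ff'.
under eq_bigr do rewrite (expected_Ent_block_ent mu0) ff' UE.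
apply: le_trans (partite_factorization mu0 _ eta0 b0 b1 rge d0 (leqnn _) sb
  (flip_connected_of_totally_connected mu0 tc)
  (covariance_bounded_of_spectrally_independent mu0 si) proper f'0) _.
  by move=> A B; exact: gibbs_four_point.
apply: ler_wpM2r; last exact: leD.
by apply: sumr_ge0 => i _; exact: block_ent_ge0.
Qed.

Theorem theorem3p3 (R : realType) :
  exists C : R, 0 < C /\
  forall eta b : R, 0 < eta -> 0 < b ->
  exists c : R, 0 < c /\
  forall (V : finType) (G : sgraph V) (n Delta q : nat)
         (S : spin_system R q) (bc : boundary_condition G q),
    #|V| = n ->
    max_degree G = Delta ->
    (3 <= Delta)%N ->
    0 < partition_function S bc ->
    totally_connected (gibbs S bc) ->
    marginally_bounded (gibbs S bc) b ->
    spectrally_independent (gibbs S bc) eta ->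
  let kappa : int := 2 + Num.ceil (2 * eta / b) in
  forall k : nat,
    [/\ KPF (gibbs S bc) G k ((Delta%:R * ln n%:R) `^ c),
        KPF (gibbs S bc) G k
          ((C * (eta + 1) ^+ 5 * Delta%:R * ln n%:R / b ^+ 6) ^ kappa)
      & KPF (gibbs S bc) G k
          ((C * (eta + 1) ^+ 5 * Delta%:R ^+ 4 / b ^+ 6) ^ kappa)].
Proof.
exists 32; split => // eta b eta0 b0.
have rho0 : 0 <= 2 * eta / b by rewrite divr_ge0 ?mulr_ge0 ?ltW.
have [r rE] : exists r : nat, Num.ceil (2 * eta / b) = r%:Z.
  exists `|Num.ceil (2 * eta / b)|%N; apply/esym/gez0_abs.
  by rewrite ceil_ge0 (lt_le_trans _ rho0) // ltrN10.
have rge : 2 * eta / b <= r%:R.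
  by have := ceil_ge (2 * eta / b); rewrite rE.
pose D : R := 32 * (eta + 1) ^+ 5 / b ^+ 6.
have [m Dm] : exists m : nat, D <= m%:R.
  by exists (Num.truncn D).+1; rewrite ltW // truncnS_gt.
exists ((m.+1 * r.+2)%:R : R); split; first by rewrite ltr0n.
move=> V G n Delta q S bc nE dE d3 Z0 tc mb si kappa k.
have kE (y : R) : y ^ kappa = y ^+ r.+2 by rewrite /kappa rE.
have d0 : (0 < max_degree G)%N by rewrite dE (leq_trans _ d3).
have n4 : (4 <= n)%N.
  by rewrite -nE; apply: leq_ltn_trans (max_degree_lt d0); rewrite dE.
have L1 : 1 <= ln (n%:R : R).
  apply: le_trans (ln4_ge1 R) _.
  by rewrite ler_ln ?posrE ?ltr0n ?(leq_trans _ n4) // ler_nat.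
have d1 : 1 <= Delta%:R :> R by rewrite ler1n (leq_trans _ d3).
have d3' : 3 <= Delta%:R :> R by rewrite ler_nat.
have e1 : 1 <= (eta + 1) ^+ 5 by apply: exprn_ege1; lra.
(* every factor beyond 32 * Delta / b ^ 4 is at least 1 *)
have base (L : R) : 1 <= L -> b <= 1 ->
    4 * (8 * b ^- 4 * Delta%:R) ^+ r.+2 <= (D * Delta%:R * L) ^+ r.+2.
  move=> L_ge1 b1.
  have i4 : 1 <= b ^- 4 by rewrite invf_ge1 ?exprn_gt0 // exprn_ile1 // ltW.
  have i2 : 1 <= b ^- 2 by rewrite invf_ge1 ?exprn_gt0 // exprn_ile1 // ltW.
  have X0 : 0 <= 8 * b ^- 4 * Delta%:R by rewrite !mulr_ge0 //; lra.
  apply: (@le_trans _ _ ((4 * (8 * b ^- 4 * Delta%:R)) ^+ r.+2)).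
    rewrite [(4 * _) ^+ _]exprMn; apply: ler_wpM2r; first exact: exprn_ge0.
    by apply: ler_eXnr => //; rewrite ler1n.
  have E1 : 1 <= (eta + 1) ^+ 5 * b ^- 2 * L by apply: mulr_ege1 => //; exact: mulr_ege1.
  have -> : D * Delta%:R * L =
      4 * (8 * b ^- 4 * Delta%:R) * ((eta + 1) ^+ 5 * b ^- 2 * L).
    by rewrite /D; field; rewrite gt_eqF.
  have X4 : 0 <= 4 * (8 * b ^- 4 * Delta%:R) by rewrite mulr_ge0.
  apply: lerXn2r; rewrite ?nnegrE //; last exact: ler_peMr.
  by rewrite mulr_ge0 // (le_trans ler01).
have kpf (C' : R) :
    (b <= 1 -> 4 * (8 * b ^- 4 * Delta%:R) ^+ r.+2 <= C') ->
    KPF (gibbs S bc) G k C'.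
  by move=> h; apply: (gibbs_KPF eta0 b0 rge) => //; rewrite dE.
split.
- apply: kpf => b1; apply: le_trans (base (ln n%:R) L1 b1) _.
  set y := Delta%:R * ln n%:R.
  have y3 : 3 <= y by apply: le_trans d3' _; apply: ler_peMr => //; lra.
  have y0 : 0 <= y by lra.
  have Dy : 0 <= D * Delta%:R * ln n%:R.
    rewrite -mulrA; apply: mulr_ge0 => //; apply: divr_ge0.
      by apply: mulr_ge0 => //; lra.
    by rewrite exprn_ge0 // ltW.
  rewrite powR_mulrn // exprM; apply: lerXn2r; rewrite ?nnegrE ?exprn_ge0 //.
  rewrite -mulrA -/y exprSr; apply: ler_wpM2r => //; apply: le_trans Dm _.
  (* D is a constant and y >= 2, so a fixed power of y absorbs D *)
  apply: (@le_trans _ _ (2 ^+ m)).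
    by rewrite -natrX ler_nat ltnW // ltn_expl.
  by apply: lerXn2r; rewrite ?nnegrE //; lra.
- apply: kpf => b1; rewrite kE; apply: le_trans (base (ln n%:R) L1 b1) _.
  rewrite le_eqVlt; apply/orP; left; apply/eqP; congr (_ ^+ _).
  by rewrite /D; field; rewrite gt_eqF.
- apply: kpf => b1; rewrite kE.
  apply: le_trans (base (Delta%:R ^+ 3) (exprn_ege1 3 d1) b1) _.
  rewrite le_eqVlt; apply/orP; left; apply/eqP; congr (_ ^+ _).
  by rewrite /D; field; rewrite gt_eqF.
Qed.
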